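(* Let $h\in\mathbb{R}^{(2n-1)p\times m}$ be the first $2n-1$ impulse-response coefficients of a system with $p$ inputs and $m$ outputs, stacked as $h=[h_1;\dots;h_{2n-1}]$ with $h_j\in\mathbb{R}^{p\times m}$. Let $\bar U\in\mathbb{R}^{T\times(2n-1)p}$ be an input matrix obtained from multiple rollouts with i.i.d. standard normal entries, let $z\in\mathbb{R}^{T\times m}$ be a noise matrix with i.i.d. $\mathcal{N}(0,\sigma_z^2)$ entries, and let $y=\bar U h+z$. Let $\hat h$ be the least-squares solution $\hat h=\arg\min_{h'}\tfrac12\|\bar U h'-y\|_F^2=h+\bar U^\dagger z$. Then, when $T\gtrsim mnp$, the spectral norm error obeys $$\|\mathcal{H}(\hat h-h)\|\lesssim\sigma_z\sqrt{\frac{mnp}{T}}\,\log(np).$$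
   Context: $\mathcal{H}(h)\in\mathbb{R}^{mn\times pn}$ is the block Hankel matrix whose $(j,k)$ block ($1\le j,k\le n$) is $h_{j+k-1}^\top\in\mathbb{R}^{m\times p}$. $\|\cdot\|$ denotes the spectral norm, $\|\cdot\|_F$ the Frobenius norm, $\bar U^\dagger$ the Moore–Penrose pseudo-inverse. The notation $a\lesssim b$ means $a\le c\,b$ for an absolute constant $c>0$ (and $\gtrsim$ similarly).
   Formalization: The bound is proved with probability at least 1 − C(np)^{-c} for absolute constants, with input and noise jointly independent and σ_z > 0, and under np ≥ 2: for n = p = 1 the right side is zero since log(np) = 0, while the error is almost surely nonzero. *)

(* Defs.v *)
From HB Require Import structures.
From mathcomp Require Import all_boot all_order all_algebra.
From mathcomp Require Import all_classical all_reals all_analysis.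
Set Implicit Arguments. Unset Strict Implicit. Unset Printing Implicit Defensive.
Import Order.TTheory GRing.Theory Num.Theory.
Local Open Scope classical_set_scope.
Local Open Scope ring_scope.

Definition mxnat (R : nmodType) (r c : nat) (A : 'M[R]_(r, c)) (i j : nat) : R :=
  match (insub i : option 'I_r), (insub j : option 'I_c) with
  | Some i', Some j' => A i' j'
  | _, _ => 0
  end.

(* Block Hankel matrix H(h) in R^{mn x pn}: block (j,k) (0-indexed) is
   h_{j+k}^T (0-indexed blocks h_0..h_{2n-2}, each p x m, stacked vertically).
   Row i of H lies in block j = i / m at position a = i mod m; column l lies
   in block k = l / p at position b = l mod p; entry = h_{j+k}(b,a). *)
Definition hankel (R : nmodType) (n p m : nat) (h : 'M[R]_((2 * n - 1) * p, m))
  : 'M[R]_(m * n, p * n) :=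
  \matrix_(i < m * n, l < p * n)
     mxnat h ((i %/ m + l %/ p) * p + l %% p) (i %% m).

Definition vnorm (R : realType) (k : nat) (v : 'cV[R]_k) : R :=
  Num.sqrt (\sum_(i < k) v i 0 ^+ 2).

Definition specnorm (R : realType) (r c : nat) (A : 'M[R]_(r, c)) : R :=
  sup [set vnorm (A *m v) | v in [set v : 'cV[R]_c | vnorm v <= 1]].

Definition frob2 (R : realType) (r c : nat) (A : 'M[R]_(r, c)) : R :=
  \sum_(i < r) \sum_(j < c) A i j ^+ 2.

Definition is_LS_solution (R : realType) (T d m : nat)
  (U : 'M[R]_(T, d)) (y : 'M[R]_(T, m)) (hh : 'M[R]_(d, m)) : Prop :=
  forall h' : 'M[R]_(d, m), frob2 (U *m hh - y) / 2 <= frob2 (U *m h' - y) / 2.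

Definition mutually_independent d (Omega : measurableType d) (R : realType)
  (P : probability Omega R) (I : finType) (X : I -> {RV P >-> R}) : Prop :=
  forall A : I -> set R, (forall i, measurable (A i)) ->
    P (\bigcap_(i in [set: I]) (X i @^-1` A i)) =
    (\prod_(i : I) P (X i @^-1` A i))%E.

(* X has law N(mu, s^2) (s = standard deviation) *)
Definition has_normal_law d (Omega : measurableType d) (R : realType)
  (P : probability Omega R) (X : {RV P >-> R}) (mu s : R) : Prop :=
  forall A : set R, measurable A -> distribution P X A = normal_prob mu s A.

Definition rmx d (Omega : measurableType d) (R : realType)
  (P : probability Omega R) (r c : nat) (X : 'I_r -> 'I_c -> {RV P >-> R})
  (w : Omega) : 'M[R]_(r, c) := \matrix_(i, j) X i j w.

(* Main.v *)
(* With [N = 2 n - 1], the symbol of the block Hankel matrix at the frequencies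
   [2 pi j / N] is built from the coordinates of [hhat - h] against [2 N p] vectors [f] of
   squared norm at most [N] (cosines and sines placed in one row of each block), and
   Parseval bounds the spectral norm by the largest Frobenius norm of the symbol.
   For a least-squares solution such a coordinate is [<U (U^T U)^-1 f, z>]; given [U] it
   is Gaussian with variance [sigma^2 f^T (U^T U)^-1 f], at most [16 sigma^2 N / T] as
   soon as [U^T U >= T / 16].  A chi-square tail bound over the [m] outputs and a union
   bound over the [2 N p] vectors then give the estimate.
   The bound [U^T U >= T / 16] comes from lower tails at the integer points of a ball of
   squared radius [34 d], [d = N p], whose number is exponential in [d], transferred to
   every vector by rounding; the loss is controlled by the Frobenius norm of [U].
   All tails follow from one exponential moment, that of the square of a linear
   combination of independent Gaussians, computed by integrating out one variable at a
   time; the coefficients may depend on the variables that are not integrated out. *)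
Require Import Defs.
From HB Require Import structures.
From mathcomp Require Import all_boot all_order all_algebra.
From mathcomp Require Import all_classical all_reals all_analysis.
From mathcomp Require Import measurable_realfun.
From mathcomp Require Import ring lra zify.
Import Order.TTheory GRing.Theory Num.Theory.
Local Open Scope classical_set_scope.
Local Open Scope ring_scope.
Set Implicit Arguments. Unset Strict Implicit. Unset Printing Implicit Defensive.

(** * Gaussian integrals *)

Section gaussian_integral.
Context {R : realType}.
Local Notation mu := (@lebesgue_measure R).

(** The Radon-Nikodym derivative of [normal_prob] and [normal_pdf] have the same integral over every
    measurable set, hence agree almost everywhere. *)
Lemma ge0_integral_normal_prob (m s : R) (f : R -> \bar R) :
  measurable_fun setT f -> (forall x, 0 <= f x)%E ->
  (\int[normal_prob m s]_x f x = \int[mu]_x (f x * (normal_pdf m s x)%:E))%E.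
Proof.
move=> mf f0.
have dom := @normal_prob_dominates R m s.
rewrite -(Radon_Nikodym_SigmaFinite.change_of_variables dom)//.
have mg := measurable_int _ (Radon_Nikodym_SigmaFinite.f_integrable dom).
have mpdf : measurable_fun setT (EFin \o normal_pdf m s).
  by apply/measurable_EFinP; exact: measurable_normal_pdf.
apply: ae_eq_integral => //.
- exact: emeasurable_funM.
- exact: emeasurable_funM.
- apply: ae_eqe_mul2l; apply: integral_ae_eq => //.
  + exact: Radon_Nikodym_SigmaFinite.f_integrable.
  + by move=> A _ mA; rewrite -Radon_Nikodym_SigmaFinite.f_integral.
Qed.

(** Completing the square: the exponent of the product is quadratic in [x] with leading coefficient
    [- D / (2 s^2)], so a Gaussian density of variance [s^2 / D] appears. *)
Lemma normal_pdf_mul_expR_sqr (s l b c x : R) : 0 < s ->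
  0 < 1 - 2 * l * s ^+ 2 * b ^+ 2 ->
  let D := 1 - 2 * l * s ^+ 2 * b ^+ 2 in
  expR (l * (b * x + c) ^+ 2) * normal_pdf 0 s x =
  (Num.sqrt D)^-1 * expR (l * c ^+ 2 / D) *
    normal_pdf (2 * l * s ^+ 2 * b * c / D) (s / Num.sqrt D) x.
Proof.
move=> s0 D0 D; rewrite -/D in D0.
have sD0 : 0 < Num.sqrt D by rewrite sqrtr_gt0.
rewrite !normal_pdfE ?gt_eqF ?divr_gt0//.
rewrite /normal_peak /normal_fun.
have DD : Num.sqrt D ^+ 2 = D by rewrite sqr_sqrtr// ltW.
have -> : (s / Num.sqrt D) ^+ 2 * pi *+ 2 = (s ^+ 2 * pi *+ 2) / D.
  by rewrite exprMn exprVn DD -!mulrnAl mulrAC.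
rewrite sqrtrM; last by rewrite mulrn_wge0// mulr_ge0 ?sqr_ge0 ?pi_ge0.
rewrite sqrtrV ?ltW// invfM invrK.
set K := Num.sqrt (s ^+ 2 * pi *+ 2).
have key (a k e f : R) : a != 0 -> a^-1 * e * (k * a * f) = k * (e * f).
  by move=> a0; field.
rewrite key ?gt_eqF// mulrCA -!expRD; congr (_ * expR _).
rewrite exprMn exprVn DD.
have Dn : D != 0 by rewrite gt_eqF.
have sn : s != 0 by rewrite gt_eqF.
rewrite subr0; rewrite /D in Dn *.
by field; rewrite sn Dn.
Qed.

Lemma integral_normal_expR_sqr (s l b c : R) : 0 < s ->
  0 < 1 - 2 * l * s ^+ 2 * b ^+ 2 ->
  (\int[normal_prob 0%R s]_x (expR (l * (b * x + c) ^+ 2))%:E =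
  ((Num.sqrt (1 - 2 * l * s ^+ 2 * b ^+ 2))^-1 *
    expR (l * c ^+ 2 / (1 - 2 * l * s ^+ 2 * b ^+ 2)))%:E)%E.
Proof.
move=> s0 D0.
rewrite ge0_integral_normal_prob; last 2 first.
- apply/measurable_EFinP; apply: measurableT_comp => //.
  apply: measurable_funM => //; apply: measurable_funX.
  by apply: measurable_funD => //; apply: measurable_funM.
- by move=> x; rewrite lee_fin expR_ge0.
under eq_integral => x _ do rewrite -EFinM normal_pdf_mul_expR_sqr// EFinM.
rewrite ge0_integralZl_EFin//.
- by rewrite integral_normal_pdf mule1.
- by move=> x _; rewrite lee_fin normal_pdf_ge0.
- by apply/measurable_EFinP; exact: measurable_normal_pdf.
Qed.

End gaussian_integral.

(** * Independence and integrating out one variable *)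

Lemma measurable_inv (R : realType) : measurable_fun setT (fun x : R => x^-1).
Proof.
(* The factor [x] makes the identity hold at [0] as well, where the inverse is [0] by convention. *)
have -> : (fun x : R => x^-1) = (fun x => x * powR (x ^+ 2) (-1)).
  apply/funext => x; have [->|x0] := eqVneq x 0; first by rewrite invr0 mul0r.
  by rewrite powRN powRr1 ?sqr_ge0// expr2 invfM mulrA divff// mul1r.
apply: measurable_funM => //.
apply: (measurableT_comp (measurable_powR _)).
exact: measurable_funX.
Qed.

Lemma measurable_funV d (T : measurableType d) (R : realType) (D : set T)
    (f : T -> R) : measurable_fun D f -> measurable_fun D (fun x => (f x)^-1).
Proof. exact: measurableT_comp (@measurable_inv R). Qed.

Lemma measurable_fun_sqrtr d (T : measurableType d) (R : realType) (D : set T)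
    (f : T -> R) :
  measurable_fun D f -> measurable_fun D (fun x => Num.sqrt (f x)).
Proof.
apply: measurableT_comp.
apply: continuous_measurable_fun; exact: sqrt_continuous.
Qed.

Section independence.
Context d (Omega : measurableType d) (R : realType) (P : probability Omega R).
Context (I : finType) (X : I -> {RV P >-> R}).

(** A pi-system generating the sigma-algebra of the variables indexed by [J]; the form of its
    members matches [mutually_independent]. *)
Definition cylinders (J : {set I}) : set (set Omega) :=
  [set B | exists A : I -> set R, [/\ forall i, measurable (A i),
     forall i, i \notin J -> A i = setT &
     B = \bigcap_(i in [set: I]) (X i @^-1` A i)]].

(** The same points as [Omega] under a coarser sigma-algebra; as a measurable type it can be a
    factor of a product space. *)
Definition sub_space (J : {set I}) := g_sigma_algebraType (cylinders J).

Definition meas_wrt (J : {set I}) (f : Omega -> R) :=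
  measurable_fun [set: sub_space J] (f : sub_space J -> R).

Lemma cylinders_measurable J : cylinders J `<=` measurable.
Proof.
move=> B [A [mA _ ->]]; apply: fin_bigcap_measurable; first exact: finite_finset.
move=> i _; rewrite -[X in measurable X]setTI; exact: measurable_funP.
Qed.

Lemma sub_space_measurable J (B : set Omega) :
  (measurable (B : set (sub_space J))) -> measurable B.
Proof.
apply: smallest_sub; last exact: cylinders_measurable.
exact: sigma_algebra_measurable.
Qed.

Lemma cylinders_setI J : setI_closed (cylinders J).
Proof.
move=> _ _ [A [mA AT ->]] [B [mB BT ->]].
exists (fun i => A i `&` B i); split.
- by move=> i; exact: measurableI.
- by move=> i iJ; rewrite AT// BT// setTI.
- by rewrite -bigcapI; apply: eq_bigcapr => i _; rewrite preimage_setI.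
Qed.

Lemma cylinders_setT J : cylinders J setT.
Proof.
exists (fun=> setT); split => //.
by apply/esym/seteqP; split => // w _ i _.
Qed.

Lemma cylinders_subset (J K : {set I}) : J \subset K ->
  cylinders J `<=` cylinders K.
Proof.
move=> /fintype.subsetP JK _ [A [mA AT ->]]; exists A; split => // i iK; apply: AT.
by apply: contra iK; exact: JK.
Qed.

Lemma meas_wrt_subset (J K : {set I}) f : J \subset K ->
  meas_wrt J f -> meas_wrt K f.
Proof.
move=> JK mf _ B mB; have := mf measurableT B mB.
rewrite /measurable /=; apply: sub_smallest2r; first exact: smallest_sigma_algebra.
exact: cylinders_subset.
Qed.

Lemma meas_wrt_RV (J : {set I}) i : i \in J -> meas_wrt J (X i).
Proof.
move=> iJ _ B mB; rewrite setTI; apply: sub_sigma_algebra.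
exists (fun k => if k == i then B else setT); split.
- by move=> k; case: ifP.
- by move=> k; case: ifPn => // /eqP ->; rewrite iJ.
- apply/seteqP; split => [w Bw k _|w /(_ i Logic.I)]; last by rewrite eqxx.
  by case: ifPn => //= /eqP ->.
Qed.

Lemma meas_wrt_measurable J (f : Omega -> R) :
  meas_wrt J f -> measurable_fun setT f.
Proof.
by move=> mf _ B mB; apply: (@sub_space_measurable J); exact: mf.
Qed.

Hypothesis indepX : mutually_independent X.

Lemma indep_cylinders (J : {set I}) i (A : set R) (B : set Omega) :
  i \notin J -> measurable A -> cylinders J B ->
  P (X i @^-1` A `&` B) = (P (X i @^-1` A) * P B)%E.
Proof.
move=> iJ mA [C [mC CT ->]].
pose C' k := if k == i then A else C k.
have -> : X i @^-1` A `&` \bigcap_(k in [set: I]) (X k @^-1` C k) =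
          \bigcap_(k in [set: I]) (X k @^-1` C' k).
  apply/seteqP; split => [w [Aw Cw] k _|w Cw].
    rewrite /C'; case: ifPn => [/eqP->//|_]; exact: Cw.
  split; first by have := Cw i Logic.I; rewrite /C' eqxx.
  move=> k _; have := Cw k Logic.I; rewrite /C'; case: ifPn => // /eqP -> _.
  by rewrite CT.
rewrite !indepX//; last by move=> k; rewrite /C'; case: ifP.
rewrite (bigD1 i)//= [in RHS](bigD1 i)//= /C' eqxx CT// preimage_setT.
rewrite probability_setT mul1e; congr (_ * _)%E.
by apply: eq_bigr => k /negbTE ->.
Qed.

(** Both sides are finite measures in [B] that agree on the pi-system of cylinders, hence on the
    sigma-algebra it generates. *)
Lemma indep_sub_space (J : {set I}) i (A : set R) (B : set Omega) :
  i \notin J -> measurable A -> measurable (B : set (sub_space J)) ->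
  P (X i @^-1` A `&` B) = (P (X i @^-1` A) * P B)%E.
Proof.
move=> iJ mA mB.
have mXA : measurable (X i @^-1` A).
  by rewrite -[X in measurable X]setTI; exact: measurable_funP.
have Pfin : P (X i @^-1` A) \is a fin_num by exact: fin_num_measure.
have p0 : 0 <= fine (P (X i @^-1` A)) by rewrite fine_ge0.
rewrite setIC -(fineK Pfin).
apply: (g_sigma_algebra_measure_unique (cylinders J) _ (fun=> setT) _ _
  (mrestr P mXA) (mscale (NngNum p0) P)) => //.
- exact: cylinders_measurable.
- by move=> _; exact: cylinders_setT.
- by rewrite bigcup_const//; exists 0%N.
- exact: cylinders_setI.
- move=> C JC.
  rewrite [LHS](_ : _ = P (C `&` X i @^-1` A))// setIC (indep_cylinders iJ)//.
  by rewrite [RHS](_ : _ = ((fine (P (X i @^-1` A)))%:E * P C)%E)// fineK.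
- move=> _; rewrite [ltLHS](_ : _ = P (setT `&` X i @^-1` A))// setTI.
  by rewrite ltey_eq Pfin.
Qed.

Let sub_space_id J : Omega -> sub_space J := fun w => w.

Lemma measurable_sub_space_id J : measurable_fun setT (@sub_space_id J).
Proof.
by move=> _ B mB; rewrite setTI; exact: (@sub_space_measurable J).
Qed.

Let pair_map i J (w : Omega) : R * sub_space J := (X i w, w).

Lemma measurable_pair_map i J : measurable_fun setT (@pair_map i J).
Proof.
apply: measurable_fun_pair; last exact: measurable_sub_space_id.
exact: measurable_funP.
Qed.

(** By independence the joint law of [X i] and the identity into [sub_space J] is a product measure;
    Tonelli does the rest. *)
Lemma ge0_integral_indep (J : {set I}) i (F : R * sub_space J -> \bar R) :
  i \notin J -> measurable_fun setT F -> (forall x, 0 <= F x)%E ->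
  (\int[P]_w F (X i w, w) =
   \int[P]_w \int[distribution P (X i)]_x F (x, w))%E.
Proof.
move=> iJ mF F0.
pose idJ : {mfun Omega >-> sub_space J} :=
  HB.pack (@sub_space_id J)
    (isMeasurableFun.Build _ _ _ _ _ (@measurable_sub_space_id J)).
pose pr : {mfun Omega >-> (R * sub_space J)%type} :=
  HB.pack (@pair_map i J)
    (isMeasurableFun.Build _ _ _ _ _ (@measurable_pair_map i J)).
transitivity (\int[distribution P pr]_z F z)%E.
  by rewrite ge0_integral_distribution.
transitivity (\int[distribution P (X i) \x distribution P idJ]_z F z)%E.
  apply: eq_measure_integral => B mB _; apply/esym.
  apply: product_measure_unique => // A C mA mC.
  exact: (indep_sub_space iJ).
rewrite fubini_tonelli2// ge0_integral_distribution//.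
- exact: measurable_fun_fubini_tonelli_G.
- by move=> w; apply: integral_ge0.
Qed.

Variable s : R.

(** The weight and the coefficients see only the variables in [J], so they are constants in the
    inner integral over [X i], which is the explicit Gaussian one. *)
Lemma expect_expR_sqr_step (J : {set I}) i (A l b c : Omega -> R) :
  0 < s -> has_normal_law (X i) 0 s -> i \notin J ->
  meas_wrt J A -> meas_wrt J l -> meas_wrt J b -> meas_wrt J c ->
  (forall w, 0 <= A w) ->
  (forall w, 0 < 1 - 2 * l w * s ^+ 2 * b w ^+ 2) ->
  (\int[P]_w (A w * expR (l w * (b w * X i w + c w) ^+ 2))%:E =
   \int[P]_w (A w * ((Num.sqrt (1 - 2 * l w * s ^+ 2 * b w ^+ 2))^-1 *
     expR (l w * c w ^+ 2 / (1 - 2 * l w * s ^+ 2 * b w ^+ 2))))%:E)%E.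
Proof.
move=> s0 nX iJ mA ml mb mc A0 D0.
pose F (z : R * sub_space J) : \bar R :=
  (A z.2 * expR (l z.2 * (b z.2 * z.1 + c z.2) ^+ 2))%:E.
have m2 (f : Omega -> R) : meas_wrt J f ->
    measurable_fun [set: R * sub_space J] (fun z => f z.2).
  by move=> mf; exact: (measurableT_comp (f := f : sub_space J -> R)).
have mexp : measurable_fun [set: R * sub_space J]
    (fun z => expR (l z.2 * (b z.2 * z.1 + c z.2) ^+ 2)).
  apply: measurableT_comp => //; apply: measurable_funM; first exact: m2.
  apply: measurable_funX; apply: measurable_funD; last exact: m2.
  by apply: measurable_funM; first exact: m2.
have mF : measurable_fun setT F.
  by apply/measurable_EFinP; apply: measurable_funM => //; exact: m2.
have F0 x : (0 <= F x)%E by rewrite lee_fin mulr_ge0 ?expR_ge0.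
rewrite (ge0_integral_indep iJ mF F0).
apply: eq_integral => w _; rewrite /F /=.
under eq_integral do rewrite EFinM.
rewrite ge0_integralZl_EFin//; last first.
  apply/measurable_EFinP; apply: measurableT_comp => //.
  apply: measurable_funM => //; apply: measurable_funX.
  by apply: measurable_funD => //; apply: measurable_funM.
rewrite EFinM -(integral_normal_expR_sqr _ s0 (D0 w)); congr (_ * _)%E.
(* The law of [X i] is carried over to [measurableTypeR R] by passing through an integral over
   [Omega]; there it is compared with [normal_prob]. *)
have mX : measurable_fun setT (X i : Omega -> measurableTypeR R).
  by move=> _ B mB; exact: (@measurable_funP _ _ _ _ setT (X i)).
pose X' : {mfun Omega >-> measurableTypeR R} :=
  HB.pack (X i : Omega -> measurableTypeR R)
    (isMeasurableFun.Build _ _ _ _ _ mX).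
pose f (x : R) := (expR (l w * (b w * x + c w) ^+ 2))%:E.
have f0 x : (0 <= f x)%E by rewrite lee_fin expR_ge0.
transitivity (\int[P]_w' f (X i w'))%E.
  rewrite ge0_integral_distribution//.
  apply/measurable_EFinP; apply: measurableT_comp => //.
  apply: measurable_funM => //; apply: measurable_funX.
  by apply: measurable_funD => //; apply: measurable_funM.
transitivity (\int[distribution P X']_y f y)%E.
  rewrite ge0_integral_distribution//.
  apply/measurable_EFinP; apply: measurableT_comp => //.
  apply: measurable_funM => //; apply: measurable_funX.
  by apply: measurable_funD => //; apply: measurable_funM.
by apply: eq_measure_integral => B mB _; exact: nX.
Qed.

End independence.

(** Positivity passes from a full sum of squares to a partial one: for [l > 0] dropping [z] only
    increases the factor, and for [l <= 0] the factor is at least [1]. *)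
Lemma gauss_factor_gt0 (R : realType) (l x y z : R) :
  0 <= x -> 0 <= y -> 0 <= z ->
  0 < 1 - 2 * l * x * (z + y) -> 0 < 1 - 2 * l * x * y.
Proof.
move=> x0 y0 z0; have [l0|l0] := leP l 0.
  have : 0 <= - l * x * y by rewrite !mulr_ge0// oppr_ge0.
  by nra.
have : 0 <= l * x * z by rewrite !mulr_ge0// ltW.
by nra.
Qed.

(** * Exponential moments of squares of Gaussian combinations *)

Section chi_square.
Context d (Omega : measurableType d) (R : realType) (P : probability Omega R).
Context (I : finType) (X : I -> {RV P >-> R}).
Hypothesis indepX : mutually_independent X.

Lemma meas_wrt_sum (K : eqType) (r : seq K) J (f : K -> Omega -> R) :
  (forall i, i \in r -> meas_wrt X J (f i)) ->
  meas_wrt X J (fun w => \sum_(i <- r) f i w).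
Proof.
move=> mf; rewrite /meas_wrt.
have -> : (fun w => \sum_(i <- r) f i w) =
          (fun w => \sum_(i <- r) (if i \in r then f i w else 0)).
  by apply/funext => w; apply: eq_big_seq => i ->.
by apply: measurable_sum => i; case: (boolP (i \in r)) => // /mf.
Qed.

Lemma meas_wrt_expR_sqr J (l c : Omega -> R) : meas_wrt X J l -> meas_wrt X J c ->
  meas_wrt X J (fun w => expR (l w * c w ^+ 2)).
Proof.
move=> ml mc; apply: (measurableT_comp (@measurable_expR R)).
apply: measurable_funM => //.
exact: measurable_funX.
Qed.

Lemma meas_wrt_gauss_factor J (l D : Omega -> R) (s : R) :
  meas_wrt X J l -> meas_wrt X J D ->
  meas_wrt X J (fun w => 1 - 2 * l w * s ^+ 2 * D w).
Proof.
move=> ml mD; apply: measurable_funB => //; apply: measurable_funM => //.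
by apply: measurable_funM => //; apply: measurable_funM.
Qed.

(* With [l' := l / D], integrating out one more variable replaces [1 / l'] by
   [1 / l' - 2 s^2 b^2], and the factors [D^(-1/2)] telescope. *)
Lemma expect_expR_sqr_seq (s : R) (r : seq I) (J : {set I}) (A l c : Omega -> R)
    (b : I -> Omega -> R) :
  0 < s -> uniq r -> (forall i, i \in r -> i \notin J) ->
  (forall i, i \in r -> has_normal_law (X i) 0 s) ->
  meas_wrt X J A -> meas_wrt X J l -> meas_wrt X J c ->
  (forall i, i \in r -> meas_wrt X J (b i)) ->
  (forall w, 0 <= A w) ->
  (forall w, 0 < 1 - 2 * l w * s ^+ 2 * \sum_(i <- r) b i w ^+ 2) ->
  (\int[P]_w (A w * expR (l w * (\sum_(i <- r) b i w * X i w + c w) ^+ 2))%:E =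
   \int[P]_w (A w *
     ((Num.sqrt (1 - 2 * l w * s ^+ 2 * \sum_(i <- r) b i w ^+ 2))^-1 *
     expR (l w * c w ^+ 2 /
       (1 - 2 * l w * s ^+ 2 * \sum_(i <- r) b i w ^+ 2))))%:E)%E.
Proof.
move=> s0; elim: r J A l c => [|k r IH] J A l c.
  move=> _ _ _ _ _ _ _ _ _; apply: eq_integral => w _; rewrite !big_nil.
  by rewrite mulr0 subr0 sqrtr1 invr1 mul1r mulr1 add0r.
move=> /= /andP[kr ur] rJ nX mA ml mc mb A0 D0.
have kJ : k \notin J by apply: rJ; rewrite mem_head.
have mbk : meas_wrt X J (b k) by apply: mb; rewrite mem_head.
have JkJ : J \subset k |: J by exact: finset.subsetUr.
pose D' w := 1 - 2 * l w * s ^+ 2 * \sum_(i <- r) b i w ^+ 2.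
have mD' : meas_wrt X J D'.
  apply: meas_wrt_gauss_factor => //; apply: meas_wrt_sum => i ir.
  by apply: measurable_funX; apply: mb; rewrite in_cons ir orbT.
have S0 w : 0 <= \sum_(i <- r) b i w ^+ 2.
  by apply: sumr_ge0 => i _; rewrite sqr_ge0.
have D'0 w : 0 < D' w.
  have := D0 w; rewrite big_cons; apply: gauss_factor_gt0 => //; exact: sqr_ge0.
transitivity (\int[P]_w (A w * expR (l w * (\sum_(i <- r) b i w * X i w +
    (b k w * X k w + c w)) ^+ 2))%:E)%E.
  by apply: eq_integral => w _; rewrite big_cons -addrA addrCA.
rewrite (IH (k |: J)); last 9 first.
- exact: ur.
- move=> i ir; rewrite in_setU1 negb_or (rJ i) ?in_cons ?ir ?orbT// andbT.
  by apply: contra kr => /eqP <-.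
- by move=> i ir; apply: nX; rewrite in_cons ir orbT.
- exact: meas_wrt_subset mA.
- exact: meas_wrt_subset ml.
- apply: measurable_funD; last exact: meas_wrt_subset mc.
  apply: measurable_funM; first exact: meas_wrt_subset mbk.
  by apply: meas_wrt_RV; rewrite finset.setU11.
- by move=> i ir; apply: (meas_wrt_subset JkJ); apply: mb; rewrite in_cons ir orbT.
- exact: A0.
- exact: D'0.
transitivity (\int[P]_w ((A w * (Num.sqrt (D' w))^-1) *
    expR ((l w / D' w) * (b k w * X k w + c w) ^+ 2))%:E)%E.
  apply: eq_integral => w _; rewrite -/(D' w) mulrA.
  by congr ((_ * expR _)%:E); rewrite mulrAC.
have DD w : D' w * (1 - 2 * (l w / D' w) * s ^+ 2 * b k w ^+ 2) =
    1 - 2 * l w * s ^+ 2 * \sum_(i <- k :: r) b i w ^+ 2.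
  rewrite big_cons mulrBr mulr1.
  have -> : D' w * (2 * (l w / D' w) * s ^+ 2 * b k w ^+ 2) =
      2 * l w * s ^+ 2 * b k w ^+ 2.
    by field; rewrite gt_eqF.
  by rewrite /D'; ring.
have E0 w : 0 < 1 - 2 * (l w / D' w) * s ^+ 2 * b k w ^+ 2.
  by rewrite -(pmulr_rgt0 _ (D'0 w)) DD.
rewrite (expect_expR_sqr_step indepX (s := s) (J := J)); last 9 first.
- exact: s0.
- by apply: nX; rewrite mem_head.
- exact: kJ.
- apply: measurable_funM => //; apply: measurable_funV.
  exact: measurable_fun_sqrtr.
- by apply: measurable_funM => //; apply: measurable_funV.
- exact: mbk.
- exact: mc.
- by move=> w; rewrite mulr_ge0// invr_ge0 sqrtr_ge0.
- exact: E0.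
apply: eq_integral => w _; rewrite -DD sqrtrM ?ltW// invfM.
have := E0 w; set E := 1 - _ => Ew; rewrite !mulrA; congr ((_ * expR _)%:E).
by move: (D'0 w) Ew; move: E (D' w) => E D'w h1 h2; field; rewrite !gt_eqF.
Qed.

(** The groups [g a] are disjoint, so they can be integrated out one after another: the squares of
    the later groups are absorbed into the weight, after adding their indices to [J]. The constant
    term is [0], so only the square-root factor survives. *)
Lemma expect_prod_expR_sqr (s : R) (K : eqType) (rs : seq K) (g : K -> seq I)
    (J : {set I}) (A : Omega -> R) (l : K -> Omega -> R)
    (b : K -> I -> Omega -> R) :
  0 < s -> uniq (flatten [seq g a | a <- rs]) ->
  (forall a i, a \in rs -> i \in g a -> i \notin J) ->
  (forall a i, a \in rs -> i \in g a -> has_normal_law (X i) 0 s) ->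
  meas_wrt X J A -> (forall a, meas_wrt X J (l a)) ->
  (forall a i, meas_wrt X J (b a i)) ->
  (forall w, 0 <= A w) ->
  (forall a w, 0 < 1 - 2 * l a w * s ^+ 2 * \sum_(i <- g a) b a i w ^+ 2) ->
  (\int[P]_w (A w *
     \prod_(a <- rs) expR (l a w * (\sum_(i <- g a) b a i w * X i w) ^+ 2))%:E =
   \int[P]_w (A w * \prod_(a <- rs)
     (Num.sqrt (1 - 2 * l a w * s ^+ 2 * \sum_(i <- g a) b a i w ^+ 2))^-1)%:E)%E.
Proof.
move=> s0; elim: rs A => [|a rs IH] A.
  by move=> *; apply: eq_integral => w _; rewrite !big_nil.
rewrite /= cat_uniq => /and3P[ua /hasPn disj urs] gJ nX mA ml mb A0 D0.
pose J' := J :|: [set i in flatten [seq g a | a <- rs]].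
have JJ' : J \subset J' by exact: finset.subsetUl.
pose Q w := \prod_(a <- rs) expR (l a w * (\sum_(i <- g a) b a i w * X i w) ^+ 2).
have mQ : meas_wrt X J' Q.
  apply: measurable_prod => a' a'rs; apply: meas_wrt_expR_sqr.
    exact: meas_wrt_subset (ml _).
  apply: meas_wrt_sum => i ia'; apply: measurable_funM.
    exact: meas_wrt_subset (mb _ _).
  apply: meas_wrt_RV; rewrite !inE; apply/orP; right.
  by apply/flattenP; exists (g a') => //; apply: map_f.
have Q0 w : 0 <= Q w by apply: prodr_ge0 => i _; rewrite expR_ge0.
transitivity (\int[P]_w ((A w * Q w) *
    expR (l a w * (\sum_(i <- g a) b a i w * X i w + 0) ^+ 2))%:E)%E.
  by apply: eq_integral => w _; rewrite big_cons addr0 -!mulrA (mulrC (Q w)).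
rewrite (expect_expR_sqr_seq (s := s) (J := J'))//; last 7 first.
- move=> i ia; rewrite !inE negb_or (gJ a) ?mem_head//=.
  by apply/negP => /disj; rewrite ia.
- by move=> i ia; apply: (nX a); rewrite ?mem_head.
- by apply: measurable_funM => //; exact: meas_wrt_subset mA.
- exact: meas_wrt_subset (ml _).
- exact: measurable_cst.
- by move=> i _; exact: meas_wrt_subset (mb _ _).
- by move=> w; rewrite mulr_ge0.
pose A' w := A w *
  (Num.sqrt (1 - 2 * l a w * s ^+ 2 * \sum_(i <- g a) b a i w ^+ 2))^-1.
transitivity (\int[P]_w (A' w * Q w)%:E)%E.
  apply: eq_integral => w _; rewrite expr0n /= mulr0 mul0r expR0 mulr1.
  by rewrite /A' mulrAC.
rewrite /Q IH//.
- by apply: eq_integral => w _; rewrite big_cons mulrA.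
- by move=> a' i a'rs; apply: gJ; rewrite in_cons a'rs orbT.
- by move=> a' i a'rs; apply: nX; rewrite in_cons a'rs orbT.
- apply: measurable_funM => //; apply: measurable_funV.
  apply: measurable_fun_sqrtr; apply: meas_wrt_gauss_factor => //.
  by apply: meas_wrt_sum => i _; apply: measurable_funX; exact: mb.
- by move=> w; rewrite mulr_ge0// invr_ge0 sqrtr_ge0.
Qed.

End chi_square.

(** * Spectral norm of block Hankel matrices *)

(** Lagrange's identity: twice the difference of the two sides is the sum of the squares of all
    [X k * Y l - X l * Y k]. *)
Lemma cauchy_schwarz_sum (R : realFieldType) (K : finType) (X Y : K -> R) :
  (\sum_k X k * Y k) ^+ 2 <= (\sum_k X k ^+ 2) * (\sum_k Y k ^+ 2).
Proof.
have E1 : (\sum_k X k * Y k) ^+ 2 =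
    \sum_k \sum_l (X k * Y k) * (X l * Y l).
  rewrite expr2 mulr_suml; apply: eq_bigr => k _; by rewrite mulr_sumr.
have E2 : (\sum_k X k ^+ 2) * (\sum_k Y k ^+ 2) =
    \sum_k \sum_l X k ^+ 2 * Y l ^+ 2.
  rewrite mulr_suml; apply: eq_bigr => k _; by rewrite mulr_sumr.
have E3 : (\sum_k X k ^+ 2) * (\sum_k Y k ^+ 2) =
    \sum_k \sum_l X l ^+ 2 * Y k ^+ 2 by rewrite E2 exchange_big.
have : 0 <= \sum_k \sum_l (X k * Y l - X l * Y k) ^+ 2.
  by apply: sumr_ge0 => k _; apply: sumr_ge0 => l _; rewrite sqr_ge0.
have -> : \sum_k \sum_l (X k * Y l - X l * Y k) ^+ 2 =
    (\sum_k X k ^+ 2) * (\sum_k Y k ^+ 2) +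
    (\sum_k X k ^+ 2) * (\sum_k Y k ^+ 2) - 2 * (\sum_k X k * Y k) ^+ 2.
  rewrite {1}E2 E3 E1 -big_split/= mulr_sumr -sumrB; apply: eq_bigr => k _.
  rewrite -big_split/= mulr_sumr -sumrB; apply: eq_bigr => l _; ring.
set a := (\sum_k X k * Y k) ^+ 2; set b := _ * _; lra.
Qed.

Lemma cauchy_schwarz_sum2 (R : realFieldType) (K : finType) (X Y X' Y' : K -> R) :
  (\sum_k (X k * Y k + X' k * Y' k)) ^+ 2 <=
  (\sum_k (X k ^+ 2 + X' k ^+ 2)) * (\sum_k (Y k ^+ 2 + Y' k ^+ 2)).
Proof.
pose F (A B : K -> R) (k : K + K) := match k with inl k => A k | inr k => B k end.
have := cauchy_schwarz_sum (F X X') (F Y Y').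
by rewrite !big_sumType/= -!big_split.
Qed.

Section hankel_norm.
Context {R : realType}.

Definition freq (N j : nat) : R := 2 * pi * j%:R / N%:R.

Lemma sin_mul_natpi (k : nat) : sin (pi *+ k : R) = 0.
Proof.
elim: k => [|k IH]; first by rewrite mulr0n sin0.
by rewrite mulrS addrC sinDpi IH oppr0.
Qed.

(** The sum telescopes because [2 sin (t/2) cos (t j) = sin (t j + t/2) - sin (t j - t/2)]. *)
Lemma sum_cos_telescope (N : nat) (t : R) :
  (\sum_(j < N) cos (t * j%:R)) * (2 * sin (t / 2)) =
  sin (t * N%:R - t / 2) + sin (t / 2).
Proof.
elim: N => [|N IH]; first by rewrite big_ord0 mul0r mulr0 sub0r sinN addNr.
rewrite big_ord_recr/= mulrDl IH.
have -> : t * N.+1%:R - t / 2 = t * N%:R + t / 2.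
  by rewrite -natr1 mulrDr mulr1 -addrA; congr (_ + _); field.
by rewrite sinB sinD; ring.
Qed.

(** Orthogonality of the characters of [Z/N] in real form. For [s] and [k] distinct the sum is one
    of [cos (t j)] with [t/2] strictly between [0] and [pi], so [sin (t/2)] can be cancelled, and
    [t N] is a multiple of [2 pi]. *)
Lemma sum_cos_freq (N s k : nat) : (s < N)%N -> (k < N)%N ->
  \sum_(j < N) (cos (freq N j * s%:R) * cos (freq N j * k%:R) +
                sin (freq N j * s%:R) * sin (freq N j * k%:R)) =
  if s == k then N%:R else 0.
Proof.
have gen (a b : nat) : (a < b)%N -> (b < N)%N ->
    \sum_(j < N) (cos (freq N j * b%:R) * cos (freq N j * a%:R) +
                  sin (freq N j * b%:R) * sin (freq N j * a%:R)) = 0.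
  move=> ab bN; have N0 : (0 < N)%N by exact: leq_ltn_trans bN.
  pose k' := (b - a)%N; have k0 : (0 < k')%N by rewrite subn_gt0.
  have kN : (k' < N)%N by exact: leq_ltn_trans (leq_subr _ _) bN.
  pose t : R := 2 * pi * k'%:R / N%:R.
  have Nn : N%:R != 0 :> R by rewrite pnatr_eq0 -lt0n.
  have -> : \sum_(j < N) (cos (freq N j * b%:R) * cos (freq N j * a%:R) +
                  sin (freq N j * b%:R) * sin (freq N j * a%:R)) =
            \sum_(j < N) cos (t * j%:R).
    apply: eq_bigr => j _; rewrite -cosB; congr (cos _).
    rewrite -mulrBr -natrB ?(ltnW ab)// -/k' /freq /t.
    by rewrite mulrAC [RHS]mulrAC -!mulrA; congr (_ * (_ * _)); rewrite mulrCA.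
  have t2 : t / 2 = pi * (k'%:R / N%:R).
    by rewrite /t -!(mulrA 2) [LHS]mulrC divfK ?pnatr_eq0// mulrA.
  have s0 : 0 < sin (t / 2).
    apply: sin_gt0_pi; rewrite t2 mulr_gt0 ?pi_gt0 ?divr_gt0 ?ltr0n//=.
    by rewrite gtr_pMr ?pi_gt0// ltr_pdivrMr ?ltr0n// mul1r ltr_nat.
  have : (\sum_(j < N) cos (t * j%:R)) * (2 * sin (t / 2)) = 0.
    rewrite sum_cos_telescope.
    have -> : t * N%:R = pi *+ k' + pi *+ k'.
      by rewrite /t divfK// mulr_natr mulr_natl mulrnAC -mulr2n.
    rewrite sinB sinD cosD sin_mul_natpi !(mulr0, mul0r, addr0, sub0r, subr0).
    have := cos2Dsin2 (pi *+ k' : R); rewrite sin_mul_natpi expr0n addr0 expr2 => ->.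
    by rewrite mul1r addNr.
  move=> /eqP; rewrite mulf_eq0 => /orP[/eqP//|].
  by rewrite gt_eqF// mulr_gt0.
move=> sN kN; case: (ltngtP s k) => [sk|ks|->].
- rewrite -[RHS](gen _ _ sk kN); apply: eq_bigr => j _; by rewrite mulrC (mulrC (sin _)).
- exact: gen.
- under eq_bigr do rewrite -!expr2 cos2Dsin2.
  by rewrite sumr_const card_ord.
Qed.

(** Injectivity on [Q] alone suits the later use: the block number [i %/ m] determines [i] only
    among indices with a given position inside their block. *)
Lemma parseval (N : nat) (L : finType) (Q : pred L) (tau : L -> nat) (v : L -> R) :
  (forall l, tau l < N)%N -> {in Q &, injective tau} ->
  \sum_(j < N) ((\sum_(l | Q l) v l * cos (freq N j * (tau l)%:R)) ^+ 2 +
                (\sum_(l | Q l) v l * sin (freq N j * (tau l)%:R)) ^+ 2) =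
  N%:R * \sum_(l | Q l) v l ^+ 2.
Proof.
move=> tN tinj.
have sq (F : L -> R) : (\sum_(l | Q l) v l * F l) ^+ 2 =
    \sum_(l | Q l) \sum_(k | Q k) v l * v k * (F l * F k).
  rewrite expr2 mulr_suml; apply: eq_bigr => l _; rewrite mulr_sumr.
  by apply: eq_bigr => k _; ring.
under eq_bigr do rewrite !sq -big_split/=.
rewrite exchange_big/= mulr_sumr; apply: eq_bigr => l Ql.
under eq_bigr do rewrite -big_split/=.
rewrite exchange_big/= (bigD1 l)//= [X in _ + X]big1 ?addr0.
  under eq_bigr do rewrite -mulrDr.
  by rewrite -mulr_sumr sum_cos_freq// eqxx mulrC expr2.
move=> k /andP[Qk kl]; under eq_bigr do rewrite -mulrDr.
rewrite -mulr_sumr sum_cos_freq//; case: eqP => [/tinj E|_]; last by rewrite mulr0.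
by rewrite E ?eqxx in kl.
Qed.

Lemma fourier_inversion (N : nat) (g : nat -> R) k : (k < N)%N ->
  N%:R * g k = \sum_(j < N)
    ((\sum_(l < N) g l * cos (freq N j * l%:R)) * cos (freq N j * k%:R) +
     (\sum_(l < N) g l * sin (freq N j * l%:R)) * sin (freq N j * k%:R)).
Proof.
move=> kN; under eq_bigr do rewrite !mulr_suml -big_split/=.
rewrite exchange_big/= (bigD1 (Ordinal kN))//= [X in _ + X]big1 ?addr0.
  under eq_bigr do rewrite -!(mulrA (g _)) -mulrDr.
  by rewrite -mulr_sumr sum_cos_freq// eqxx mulrC.
move=> l lk; under eq_bigr do rewrite -!(mulrA (g _)) -mulrDr.
rewrite -mulr_sumr sum_cos_freq//; case: eqP => [E|_]; last by rewrite mulr0.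
by case/eqP: lk; apply: val_inj.
Qed.

(** With [u = H v], the squared norm of [u] is the bilinear form of [H] at [u] and [v]. Fourier
    inversion splits it over frequencies; Cauchy-Schwarz and the mean inequality bound each part,
    and Parseval sums them to [(|u|^2 + M^2 |v|^2) / 2], whose first half is absorbed on the
    left. *)
Lemma hankel_mulmx_bound (n p m : nat) (g : 'M[R]_((2 * n - 1) * p, m)) (M : R) :
  (0 < p)%N -> (0 < m)%N ->
  (forall j : 'I_(2 * n - 1), \sum_(a < m) \sum_(b < p)
    ((\sum_(k < 2 * n - 1) mxnat g (k * p + b) a * cos (freq (2 * n - 1) j * k%:R)) ^+ 2 +
     (\sum_(k < 2 * n - 1) mxnat g (k * p + b) a * sin (freq (2 * n - 1) j * k%:R)) ^+ 2)
    <= M ^+ 2) ->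
  forall v : 'cV[R]_(p * n),
  \sum_i (hankel g *m v) i 0 ^+ 2 <= M ^+ 2 * \sum_l v l 0 ^+ 2.
Proof.
move=> p0 m0 HM v; set N := (2 * n - 1)%N in HM *.
have [n0|n0] := posnP n.
  rewrite big1 => [|i _]; last by exfalso; have := ltn_ord i; lia.
  apply: mulr_ge0; first exact: sqr_ge0.
  by apply: sumr_ge0 => i _; exact: sqr_ge0.
have N0 : (0 < N)%N by rewrite /N; lia.
pose u (i : 'I_(m * n)) : R := (hankel g *m v) i 0.
pose A j b a := \sum_(k < N) mxnat g (k * p + b) a * cos (freq N j * k%:R).
pose B j b a := \sum_(k < N) mxnat g (k * p + b) a * sin (freq N j * k%:R).
pose ra (i : 'I_(m * n)) : 'I_m := Ordinal (ltn_pmod i m0).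
pose rb (l : 'I_(p * n)) : 'I_p := Ordinal (ltn_pmod l p0).
pose Cu j (a : 'I_m) : R := \sum_(i | ra i == a) u i * cos (freq N j * (i %/ m)%:R).
pose Su j (a : 'I_m) : R := \sum_(i | ra i == a) u i * sin (freq N j * (i %/ m)%:R).
pose Cv j (b : 'I_p) : R := \sum_(l | rb l == b) v l 0 * cos (freq N j * (l %/ p)%:R).
pose Sv j (b : 'I_p) : R := \sum_(l | rb l == b) v l 0 * sin (freq N j * (l %/ p)%:R).
(* The brackets are the real and imaginary parts of [(Cu + i Su) (Cv + i Sv)]. *)
pose T j := \sum_(a < m) \sum_(b < p) (A j b a * (Cu j a * Cv j b - Su j a * Sv j b) +
                           B j b a * (Su j a * Cv j b + Cu j a * Sv j b)).
have sn (i : 'I_(m * n)) : (i %/ m < n)%N by rewrite ltn_divLR// [(n * m)%N]mulnC.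
have tn (l : 'I_(p * n)) : (l %/ p < n)%N by rewrite ltn_divLR// [(n * p)%N]mulnC.
have NS : N%:R * \sum_i u i ^+ 2 = \sum_(j < N) T j.
  transitivity (\sum_i \sum_l u i * v l 0 * (N%:R *
      mxnat g ((i %/ m + l %/ p) * p + l %% p) (i %% m))).
    rewrite mulr_sumr; apply: eq_bigr => i _.
    rewrite expr2 {2}/u mxE mulrA mulr_sumr; apply: eq_bigr => l _.
    by rewrite mxE; ring.
  transitivity (\sum_i \sum_l \sum_(j < N) u i * v l 0 *
     (A j (l %% p)%N (i %% m)%N * cos (freq N j * (i %/ m + l %/ p)%:R) +
      B j (l %% p)%N (i %% m)%N * sin (freq N j * (i %/ m + l %/ p)%:R))).
    apply: eq_bigr => i _; apply: eq_bigr => l _; rewrite -mulr_sumr; congr (_ * _).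
    (* Two block numbers below [n] add up to at most [2 n - 2 = N - 1], so there is no wrap-around
       modulo [N]. *)
    apply: (fourier_inversion (fun k => mxnat g (k * p + l %% p) (i %% m))).
    by have := sn i; have := tn l; rewrite /N; lia.
  under eq_bigr do rewrite exchange_big/=.
  rewrite exchange_big/=; apply: eq_bigr => j _.
  rewrite /T (partition_big ra xpredT)//=; apply: eq_bigr => a _.
  under eq_bigr do rewrite (partition_big rb xpredT)//=.
  rewrite exchange_big/=; apply: eq_bigr => b _.
  transitivity (\sum_(i | ra i == a) \sum_(l | rb l == b) u i * v l 0 *
     (A j b a * cos (freq N j * (i %/ m + l %/ p)%:R) +
      B j b a * sin (freq N j * (i %/ m + l %/ p)%:R))).
    by apply: eq_bigr => i /eqP <-; apply: eq_bigr => l /eqP <-.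
  move: (A j b a) (B j b a) => x y.
  rewrite /Cu /Su !mulr_suml -sumrB -big_split/= !mulr_sumr -big_split/=.
  apply: eq_bigr => i _; rewrite /Cv /Sv.
  rewrite !mulr_sumr -sumrB -big_split/= !mulr_sumr -big_split/=.
  apply: eq_bigr => l _; rewrite natrD (mulrDr (freq N j)) cosD sinD.
  move: (cos _) (sin _) (cos _) (sin _) => c1 s1 c2 s2; ring.
have Tle (j : 'I_N) : T j <= (\sum_a (Cu j a ^+ 2 + Su j a ^+ 2) +
    M ^+ 2 * \sum_b (Cv j b ^+ 2 + Sv j b ^+ 2)) / 2.
  set x := \sum_a _; set y := \sum_b (Cv j b ^+ 2 + _).
  have x0 : 0 <= x by apply: sumr_ge0 => a _; rewrite addr_ge0 ?sqr_ge0.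
  have y0 : 0 <= y by apply: sumr_ge0 => a _; rewrite addr_ge0 ?sqr_ge0.
  have T2 : T j ^+ 2 <= M ^+ 2 * (x * y).
    rewrite /T pair_bigA/=.
    apply: (le_trans (cauchy_schwarz_sum2 (K := ('I_m * 'I_p)%type)
      (fun k => A j k.2 k.1) (fun k => Cu j k.1 * Cv j k.2 - Su j k.1 * Sv j k.2)
      (fun k => B j k.2 k.1) (fun k => Su j k.1 * Cv j k.2 + Cu j k.1 * Sv j k.2))).
    have -> : \sum_(k : 'I_m * 'I_p) (A j k.2 k.1 ^+ 2 + B j k.2 k.1 ^+ 2) =
        \sum_(a < m) \sum_(b < p) (A j b a ^+ 2 + B j b a ^+ 2) by rewrite pair_bigA.
    (* The modulus of a complex product is the product of the moduli. *)
    have -> : \sum_(k : 'I_m * 'I_p) ((Cu j k.1 * Cv j k.2 - Su j k.1 * Sv j k.2) ^+ 2 +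
        (Su j k.1 * Cv j k.2 + Cu j k.1 * Sv j k.2) ^+ 2) = x * y.
      rewrite /x mulr_suml.
      under [RHS]eq_bigr do rewrite mulr_sumr.
      by rewrite pair_bigA; apply: eq_bigr => k _ /=; ring.
    by rewrite ler_wpM2r ?mulr_ge0//; exact: HM.
  have [T0|T0] := leP (T j) 0.
    apply: (le_trans T0); by rewrite divr_ge0// addr_ge0// (mulr_ge0 (sqr_ge0 _)).
  rewrite -(@ler_pXn2r _ 2)// ?nnegrE ?(ltW T0) ?divr_ge0 ?addr_ge0 ?(mulr_ge0 (sqr_ge0 _))//.
  apply: (le_trans T2); move: (M ^+ 2) => M2.
  have := sqr_ge0 (x - M2 * y); rewrite -subr_ge0 => h; rewrite -subr_ge0.
  have -> : ((x + M2 * y) / 2) ^+ 2 - M2 * (x * y) = (x - M2 * y) ^+ 2 / 4 by field.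
  by rewrite divr_ge0// sqr_ge0.
have Px : \sum_(j < N) \sum_a (Cu j a ^+ 2 + Su j a ^+ 2) = N%:R * \sum_i u i ^+ 2.
  rewrite exchange_big/= (partition_big ra xpredT)//= mulr_sumr.
  apply: eq_bigr => a _; apply: parseval => [i|i k].
    by have := sn i; rewrite /N; lia.
  move=> ia ka ik; have {ia}/eqP ia : ra i == a := ia.
  have {ka}/eqP ka : ra k == a := ka; apply: val_inj => /=.
  rewrite (divn_eq i m) (divn_eq k m) ik; congr (_ + _)%N.
  by have := congr1 val (etrans ia (esym ka)).
have Py : \sum_(j < N) \sum_b (Cv j b ^+ 2 + Sv j b ^+ 2) = N%:R * \sum_l v l 0 ^+ 2.
  rewrite exchange_big/= (partition_big rb xpredT)//= mulr_sumr.
  apply: eq_bigr => a _; apply: (@parseval N _ _ (fun l : 'I_(p * n) => (l %/ p)%N)) => [i|i k].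
    by have := tn i; rewrite /N; lia.
  move=> ia ka ik; have {ia}/eqP ia : rb i == a := ia.
  have {ka}/eqP ka : rb k == a := ka; apply: val_inj => /=.
  rewrite (divn_eq i p) (divn_eq k p) ik; congr (_ + _)%N.
  by have := congr1 val (etrans ia (esym ka)).
have : N%:R * \sum_i u i ^+ 2 <= N%:R * ((\sum_i u i ^+ 2 + M ^+ 2 * \sum_l v l 0 ^+ 2) / 2).
  rewrite {1}NS; apply: (le_trans (ler_sum _ (fun j _ => Tle j))).
  by rewrite -mulr_suml big_split/= -mulr_sumr Px Py mulrCA -mulrDr mulrA.
rewrite ler_pM2l ?ltr0n// -/(u _); move: (\sum_i _ ^+ 2) (M ^+ 2 * _) => a b; lra.
Qed.

Lemma specnorm_le (r c : nat) (A : 'M[R]_(r, c)) (M : R) : 0 <= M ->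
  (forall v : 'cV[R]_c, \sum_i (A *m v) i 0 ^+ 2 <= M ^+ 2 * \sum_l v l 0 ^+ 2) ->
  specnorm A <= M.
Proof.
move=> M0 H; apply: ge_sup.
  exists (vnorm (A *m 0)); exists 0 => //=.
  by rewrite /vnorm big1 ?sqrtr0// => i _; rewrite mxE expr0n.
move=> _ [v /= v1 <-]; rewrite /vnorm -(ger0_norm M0) -sqrtr_sqr; apply: ler_wsqrtr.
apply: (le_trans (H v)); rewrite ler_piMr ?sqr_ge0//.
by move: v1; rewrite /vnorm -[X in _ <= X -> _]sqrtr1 ler_sqrt ?ltr01.
Qed.

End hankel_norm.

(** * Lattice rounding and coercivity of the Gram matrix *)

Section lattice.
Context {R : realType}.

Definition sqnorm (k : nat) (v : 'cV[R]_k) : R := \sum_i v i 0 ^+ 2.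

Lemma sqnorm_ge0 k (v : 'cV[R]_k) : 0 <= sqnorm v.
Proof. by apply: sumr_ge0 => i _; exact: sqr_ge0. Qed.

Lemma sqnormZ k (a : R) (v : 'cV[R]_k) : sqnorm (a *: v) = a ^+ 2 * sqnorm v.
Proof. by rewrite /sqnorm mulr_sumr; apply: eq_bigr => i _; rewrite mxE exprMn. Qed.

Lemma sqnorm_eq0 k (v : 'cV[R]_k) : sqnorm v = 0 -> v = 0.
Proof.
move=> v0; apply/colP => i; rewrite !mxE; apply/eqP; rewrite -sqrf_eq0.
by apply/eqP; apply: (psumr_eq0P _ v0) => // j _; exact: sqr_ge0.
Qed.

(** The quadratic form of [U^T U - kappa I]; its nonnegativity is coercivity with constant
    [kappa]. *)
Definition shifted_form (T d : nat) (U : 'M[R]_(T, d)) (kappa : R) (x : 'cV[R]_d) :=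
  sqnorm (U *m x) - kappa * sqnorm x.

Lemma shifted_form_add_coord (T d : nat) (U : 'M[R]_(T, d)) (kappa : R) (x : 'cV[R]_d)
    (j : 'I_d) (t : R) :
  shifted_form U kappa (x + t *: delta_mx j 0) =
  shifted_form U kappa x +
  2 * t * (\sum_i (U *m x) i 0 * U i j - kappa * x j 0) +
  t ^+ 2 * (\sum_i U i j ^+ 2 - kappa).
Proof.
have E1 : sqnorm (U *m (x + t *: delta_mx j 0)) = sqnorm (U *m x) +
    2 * t * (\sum_i (U *m x) i 0 * U i j) + t ^+ 2 * \sum_i U i j ^+ 2.
  rewrite /sqnorm !mulr_sumr -!big_split/=; apply: eq_bigr => i _.
  rewrite mulmxDr -scalemxAr [in LHS]mxE [X in _ + X]mxE.
  have -> : (U *m (delta_mx j 0 : 'cV[R]_d)) i 0 = U i j.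
    by rewrite -colE mxE.
  by move: ((U *m x) i 0) => a; ring.
have E2 : sqnorm (x + t *: delta_mx j 0) = sqnorm x + 2 * t * x j 0 + t ^+ 2.
  rewrite /sqnorm (bigD1 j)//= [in RHS](bigD1 j)//= !mxE !eqxx mulr1.
  rewrite (eq_bigr (fun i => x i 0 ^+ 2)); first by ring.
  by move=> i ij; rewrite !mxE (negbTE ij) mulr0 addr0.
rewrite /shifted_form E1 E2; ring.
Qed.

(* Rounding coordinate [k] up with probability equal to its fractional part leaves
   the mean of the quadratic form unchanged up to its variance term, which is at
   most a quarter of the diagonal coefficient; one of the two choices is no worse
   than the mean. *)
Lemma lattice_rounding (T d : nat) (U : 'M[R]_(T, d)) (kappa : R) (r : seq 'I_d)
    (x : 'cV[R]_d) : 0 <= kappa -> uniq r ->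
  exists y : 'cV[R]_d, [/\
    forall j, j \in r -> exists2 z : int, y j 0 = z%:~R & `|y j 0 - x j 0| <= 1,
    forall j, j \notin r -> y j 0 = x j 0 &
    shifted_form U kappa y <=
      shifted_form U kappa x + (\sum_(j <- r) \sum_i U i j ^+ 2) / 4].
Proof.
move=> k0; elim: r => [_|k r IH /= /andP[kr ur]].
  by exists x; split => //; rewrite big_nil mul0r addr0.
have [y [yr ynr yQ]] := IH ur.
have yk : y k 0 = x k 0 by exact: ynr.
pose th := x k 0 - (Num.floor (x k 0))%:~R.
have th0 : 0 <= th by rewrite subr_ge0 Num.Theory.ge_floor.
have th1 : th < 1.
  by rewrite ltrBlDr addrC -[1]/(1%:~R) -intrD; exact: Num.Theory.floorD1_gt.
pose S := \sum_i U i k ^+ 2.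
have S0 : 0 <= S by apply: sumr_ge0 => i _; exact: sqr_ge0.
suff [t [z tz tle]] : exists t, exists2 z : int, x k 0 + t = z%:~R &
    `|t| <= 1 /\ shifted_form U kappa (y + t *: delta_mx k 0) <=
    shifted_form U kappa y + S / 4.
  case: tle => t1 tQ.
  exists (y + t *: delta_mx k 0); split.
  - move=> j; rewrite in_cons => /orP[/eqP->|jr].
      exists z; rewrite !mxE !eqxx mulr1 yk//.
      by rewrite addrAC subrr add0r.
    have jk : j != k by apply: contraNneq kr => <-.
    have [z' yz' yx'] := yr j jr; exists z'; by rewrite !mxE (negbTE jk) mulr0 addr0.
  - move=> j; rewrite in_cons negb_or => /andP[jk jr].
    by rewrite !mxE (negbTE jk) mulr0 addr0 ynr.
  - rewrite big_cons -/S; apply: (le_trans tQ); move: yQ; lra.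
pose B := 2 * (\sum_i (U *m y) i 0 * U i k - kappa * y k 0).
have QE t : shifted_form U kappa (y + t *: delta_mx k 0) =
    shifted_form U kappa y + t * B + t ^+ 2 * (S - kappa).
  by rewrite shifted_form_add_coord /B /S; ring.
have [h|h] := leP (- th * B + th ^+ 2 * (S - kappa)) (S / 4).
  exists (- th); exists (Num.floor (x k 0)); first by rewrite /th opprB addrC subrK.
  by rewrite normrN ger0_norm// ltW// QE sqrrN -addrA lerD2l.
exists (1 - th); exists (Num.floor (x k 0) + 1).
  by rewrite intrD /th; ring.
split; first by rewrite ger0_norm; lra.
rewrite QE -addrA lerD2l.
have [t0|t0] := eqVneq th 0; first by move: h; rewrite t0 oppr0 mul0r expr0n mul0r addr0; lra.
have {}th0 : 0 < th by rewrite lt_def t0.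
rewrite -(ler_pM2l th0) -subr_ge0.
have mean : (1 - th) * (- th * B + th ^+ 2 * (S - kappa)) +
   th * ((1 - th) * B + (1 - th) ^+ 2 * (S - kappa)) = th * (1 - th) * (S - kappa).
  by ring.
have var : th * (1 - th) * (S - kappa) <= S / 4.
  have q0 : 0 <= th * (1 - th) by apply: mulr_ge0; lra.
  have q1 : th * (1 - th) <= 1 / 4 by have := sqr_ge0 (th - 1 / 2); nra.
  have : th * (1 - th) * kappa >= 0 by rewrite mulr_ge0.
  by move: (th * (1 - th)) q0 q1 => q q0 q1; nra.
have hh : (1 - th) * (S / 4) <= (1 - th) * (- th * B + th ^+ 2 * (S - kappa)).
  by rewrite ler_pM2l ?subr_gt0// ltW.
move: mean hh var; set a := (1 - th) * (- th * B + _); set b := th * ((1 - th) * B + _).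
set c := th * (1 - th) * _; lra.
Qed.

(** Sign and magnitude encode integer vectors in a finite type. A zero coordinate has two codes,
    which is harmless in an upper bound on their number. *)
Definition lattice_vec (d M : nat) (k : {ffun 'I_d -> bool * 'I_M.+1}) : 'cV[R]_d :=
  \col_j ((-1) ^+ (k j).1 * ((k j).2 : nat)%:R).

(** An l1 ball: since [|z| <= z^2] for integers, it contains the integer points of squared norm at
    most [M], and its size is easy to bound. *)
Definition lattice_ball (d M : nat) : {set {ffun 'I_d -> bool * 'I_M.+1}} :=
  finset (fun k : {ffun 'I_d -> bool * 'I_M.+1} => \sum_j (k j).2 <= M)%N.

Lemma sum_half_pow (M : nat) : \sum_(i < M) (2^-1 : R) ^+ i <= 2.
Proof.
have -> : \sum_(i < M) (2^-1 : R) ^+ i = 2 - 2 * 2^-1 ^+ M.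
  elim: M => [|M IH]; first by rewrite big_ord0 expr0; ring.
  by rewrite big_ord_recr/= IH exprS; lra.
have : 0 <= (2^-1 : R) ^+ M by rewrite exprn_ge0// invr_ge0.
by lra.
Qed.

(** Each point of l1 norm [s] gets weight [2^(M - s)], at least [1] in the ball. The total weight
    factors over coordinates into geometric series, each at most [4]: two signs times [2]. *)
Lemma card_lattice_ball (d M : nat) :
  (#|lattice_ball d M|)%:R <= (2 : R) ^+ M * 4 ^+ d.
Proof.
rewrite -sum1_card natr_sum.
pose F (k : {ffun 'I_d -> bool * 'I_M.+1}) : R :=
  2 ^+ M * \prod_j 2^-1 ^+ (k j).2.
have F0 k : 0 <= F k.
  apply: mulr_ge0; first exact: exprn_ge0.
  by apply: prodr_ge0 => j _; rewrite exprn_ge0 ?invr_ge0.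
apply: (@le_trans _ _ (\sum_(k in lattice_ball d M) F k)).
  apply: ler_sum => k; rewrite inE => kM; rewrite /F.
  have -> : \prod_j (2^-1 : R) ^+ (k j).2 = 2^-1 ^+ (\sum_j (k j).2).
    by rewrite (big_morph _ (exprD _) (expr0 _)).
  by rewrite exprVn ler_pdivlMr ?exprn_gt0// mul1r ler_weXn2l ?ler1n.
apply: (@le_trans _ _ (\sum_k F k)).
  by rewrite big_mkcond/=; apply: ler_sum => k _; case: ifP.
rewrite /F -mulr_sumr ler_pM2l ?exprn_gt0//.
rewrite -(bigA_distr_bigA (fun (_ : 'I_d) (v : bool * 'I_M.+1) => (2^-1 : R) ^+ v.2)).
rewrite prodr_const card_ord.
apply: lerXn2r; rewrite ?nnegrE//.
  by apply: sumr_ge0 => v _; rewrite exprn_ge0 ?invr_ge0.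
rewrite -(pair_bigA _ (fun (_ : bool) (i : 'I_M.+1) => (2^-1 : R) ^+ i))/= big_bool/=.
have := sum_half_pow M.+1; lra.
Qed.

Lemma lattice_ball_vec (d M : nat) (y : 'cV[R]_d) :
  (forall j, exists z : int, y j 0 = z%:~R) -> sqnorm y <= M%:R ->
  exists2 k, k \in lattice_ball d M & y = lattice_vec k.
Proof.
move=> yz yM.
have [z zE] : exists z : 'I_d -> int, forall j, y j 0 = (z j)%:~R.
  by exists (fun j => sval (cid (yz j))) => j; case: cid.
have zM : (\sum_j `|z j| <= M)%N.
  rewrite -(ler_nat R); apply: le_trans yM; rewrite natr_sum; apply: ler_sum => j _.
  rewrite zE -real_normK ?num_real// -intr_norm -abszE -pmulrn -natrX ler_nat.
  by case: `|z j|%N => // n; rewrite expnS leq_pmulr ?expn_gt0.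
have zj j : (`|z j| < M.+1)%N.
  by rewrite ltnS; apply: leq_trans zM; rewrite (bigD1 j)//= leq_addr.
exists [ffun j => (z j < 0, Ordinal (zj j))].
  by rewrite inE; under eq_bigr do rewrite ffunE.
apply/colP => j; rewrite zE mxE ffunE/= {1}[z j]intEsign.
by rewrite intrM rmorphXn/= rmorphN1.
Qed.

(* After scaling [x] to squared norm [16 d], rounding to an integer vector loses at most
   [d T], half of the [2 d T] guaranteed at lattice points. *)
Lemma gram_lower_bound (T d : nat) (U : 'M[R]_(T, d)) : (0 < d)%N ->
  (forall k, k \in lattice_ball d (34 * d) ->
     T%:R / 8 * sqnorm (lattice_vec k) <= sqnorm (U *m lattice_vec k)) ->
  \sum_j \sum_i U i j ^+ 2 <= 4 * (d * T)%:R ->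
  forall x, T%:R / 16 * sqnorm x <= sqnorm (U *m x).
Proof.
move=> d0 Uk UF x.
have [x0|x0] := eqVneq (sqnorm x) 0.
  by rewrite x0 mulr0 sqnorm_ge0.
have {}x0 : 0 < sqnorm x by rewrite lt_def x0 sqnorm_ge0.
pose a := Num.sqrt (16 * d%:R / sqnorm x).
have a2 : a ^+ 2 = 16 * d%:R / sqnorm x.
  by rewrite sqr_sqrtr// divr_ge0 ?mulr_ge0// ltW.
have ax : sqnorm (a *: x) = 16 * d%:R by rewrite sqnormZ a2 divfK// gt_eqF.
have kap0 : 0 <= T%:R / 8 :> R by rewrite divr_ge0.
have [y [yr _ yQ]] := lattice_rounding U (a *: x) kap0 (enum_uniq 'I_d).
have {}yr j : exists2 z : int, y j 0 = z%:~R & `|y j 0 - (a *: x) j 0| <= 1.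
  by apply: yr; rewrite mem_enum.
have yM : sqnorm y <= (34 * d)%:R.
  (* Here [34 = 2 * 16 + 2]: moving a coordinate from [q] to [p] by at most [1] gives
     [p^2 <= 2 q^2 + 2]. *)
  have -> : (34 * d)%:R = 2 * sqnorm (a *: x) + 2 * d%:R :> R.
    by rewrite ax natrM; ring.
  have -> : 2 * d%:R = \sum_(j < d) (2 : R).
    by rewrite sumr_const card_ord mulr_natr.
  rewrite /sqnorm mulr_sumr -big_split/=; apply: ler_sum => j _.
  have [_ _] := yr j; move: (y j 0) ((a *: x) j 0) => p q.
  by rewrite ler_norml => /andP[h1 h2]; have := sqr_ge0 (p - 2 * q); nra.
have [|k kB yk] := lattice_ball_vec _ yM.
  by move=> j; have [z yz _] := yr j; exists z.
have Qy : 0 <= shifted_form U (T%:R / 8) y.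
  by rewrite /shifted_form subr_ge0 yk; exact: Uk.
have : 0 <= shifted_form U (T%:R / 8) (a *: x) + d%:R * T%:R.
  apply: (le_trans Qy); apply: (le_trans yQ); rewrite lerD2l big_enum/=.
  by move: UF; rewrite natrM; lra.
rewrite /shifted_form ax -scalemxAr sqnormZ.
have a20 : 0 < a ^+ 2 by rewrite a2 divr_gt0 ?mulr_gt0 ?ltr0n.
move=> h; rewrite -(ler_pM2l a20) mulrCA -sqnormZ ax.
move: h; set b := a ^+ 2 * _; move: (T%:R : R) (d%:R : R) => t e; lra.
Qed.

End lattice.

(** * Least squares *)

Section least_squares.
Context {R : realType}.

Lemma frob2E (r c : nat) (A : 'M[R]_(r, c)) : frob2 A = \tr (A^T *m A).
Proof.
rewrite /frob2 /mxtrace exchange_big/=; apply: eq_bigr => j _.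
by rewrite mxE; apply: eq_bigr => i _; rewrite mxE expr2.
Qed.

Lemma sqnormE (k : nat) (v : 'cV[R]_k) : sqnorm v = (v^T *m v) 0 0.
Proof. by rewrite mxE; apply: eq_bigr => i _; rewrite mxE expr2. Qed.

Lemma frob2_col (r c : nat) (A : 'M[R]_(r, c)) : frob2 A = \sum_j sqnorm (col j A).
Proof.
rewrite /frob2 exchange_big/=; apply: eq_bigr => j _.
by apply: eq_bigr => i _; rewrite mxE.
Qed.

(* The inverse of the Gram matrix when it is invertible; unlike [invmx], it is given by
   one rational expression in the entries of [U], which makes it measurable. *)
Definition gram_inv (T d : nat) (U : 'M[R]_(T, d)) : 'M[R]_d :=
  (\det (U^T *m U))^-1 *: \adj (U^T *m U).

Section coercive.
Context (T d : nat) (U : 'M[R]_(T, d)) (c0 : R).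
Hypothesis c0_gt0 : 0 < c0.
Hypothesis U_lower : forall x, c0 * sqnorm x <= sqnorm (U *m x).

Lemma coercive_inj (x : 'cV[R]_d) : sqnorm (U *m x) = 0 -> x = 0.
Proof.
move=> Ux; apply: sqnorm_eq0; apply/eqP; rewrite eq_le sqnorm_ge0 andbT.
by have := U_lower x; rewrite Ux pmulr_rle0.
Qed.

Lemma gram_unit : U^T *m U \in unitmx.
Proof.
rewrite -row_free_unit; apply: inj_row_free => v vG.
apply: trmx_inj; rewrite trmx0; apply: coercive_inj.
by rewrite sqnormE trmx_mul trmxK mulmxA -[v *m _ *m _]mulmxA vG mul0mx mxE.
Qed.

Lemma gram_invE : gram_inv U = invmx (U^T *m U).
Proof. by rewrite /gram_inv /invmx gram_unit. Qed.

(** The residual of the candidate is orthogonal to the range of [U]. Pythagoras and minimality then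
    force [U] to annihilate the difference from the candidate, and coercivity makes [U]
    injective. *)
Lemma LS_solutionE (m : nat) (h hh : 'M[R]_(d, m)) (z : 'M[R]_(T, m)) :
  is_LS_solution U (U *m h + z) hh -> hh - h = gram_inv U *m U^T *m z.
Proof.
move=> LS; rewrite gram_invE; set G := U^T *m U.
pose e := invmx G *m U^T *m z; have [D DE] : {D | D = hh - h - e} by exists (hh - h - e).
have [r rE] : {r | r = U *m e - z} by exists (U *m e - z).
have Ur : U^T *m r = 0.
  by rewrite rE mulmxBr mulmxA /e !mulmxA mulmxV ?gram_unit// mul1mx subrr.
have E1 : U *m hh - (U *m h + z) = U *m D + r.
  by rewrite DE rE !mulmxBr opprD addrA subrKA.
have E2 : U *m (h + e) - (U *m h + z) = r.
  by rewrite rE mulmxDr opprD addrACA subrr add0r.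
have := LS (h + e); rewrite E1 E2 ler_pM2r ?invr_gt0//.
have -> : frob2 (U *m D + r) = frob2 (U *m D) + frob2 r.
  have z1 : (U *m D)^T *m r = 0 by rewrite trmx_mul -mulmxA Ur mulmx0.
  have z2 : r^T *m (U *m D) = 0.
    by apply: trmx_inj; rewrite trmx_mul trmxK trmx0.
  rewrite !frob2E -mxtraceD; congr (\tr _).
  have -> : (U *m D + r)^T = (U *m D)^T + r^T by apply/matrixP => i j; rewrite !mxE.
  by rewrite mulmxDl !mulmxDr z1 z2 addr0 add0r.
rewrite gerDr => UD0.
suff D0 : D = 0 by apply/eqP; rewrite -subr_eq0 -/e -DE D0.
have S0 : \sum_j sqnorm (col j (U *m D)) = 0.
  rewrite -frob2_col; apply/eqP; rewrite eq_le UD0 frob2_col.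
  by apply: sumr_ge0 => j _; exact: sqnorm_ge0.
apply/matrixP => i j; rewrite mxE.
have : col j D = 0.
  apply: coercive_inj; rewrite !colE mulmxA -colE.
  by apply: (psumr_eq0P _ S0) => // k _; exact: sqnorm_ge0.
by move/colP/(_ i); rewrite !mxE.
Qed.

(** For [x = G^-1 f], [|U x|^2 = <x, f> <= (c0 |x|^2 + |f|^2 / c0) / 2], and [c0 |x|^2 <= |U x|^2]
    is absorbed on the left. *)
Lemma sqnorm_gram_inv_le (f : 'cV[R]_d) :
  sqnorm (U *m (gram_inv U *m f)) <= sqnorm f / c0.
Proof.
rewrite gram_invE; set x := invmx _ *m f.
have xf : sqnorm (U *m x) = \sum_i x i 0 * f i 0.
  have Gx : U^T *m U *m x = f by rewrite mulmxA mulmxV ?gram_unit// mul1mx.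
  rewrite sqnormE trmx_mul -mulmxA [U^T *m (U *m x)]mulmxA Gx mxE.
  by apply: eq_bigr => i _; rewrite [x^T _ _]mxE.
have h : sqnorm (U *m x) <= (c0 * sqnorm x + sqnorm f / c0) / 2.
  rewrite xf /sqnorm !mulr_sumr mulr_suml -big_split/= mulr_suml.
  apply: ler_sum => i _; move: (x i 0) (f i 0) => a b.
  have -> : a * b = (c0 * a ^+ 2 + b ^+ 2 / c0) / 2 - (c0 * a - b) ^+ 2 / (2 * c0).
    by field; rewrite gt_eqF.
  by rewrite gerBl divr_ge0 ?sqr_ge0// mulr_ge0// ltW.
have := U_lower x; move: h; move: (sqnorm f / c0) => b; lra.
Qed.

End coercive.

Lemma gram_inv_sym (T d : nat) (U : 'M[R]_(T, d)) : (gram_inv U)^T = gram_inv U.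
Proof. by rewrite /gram_inv linearZ/= trmx_adj trmx_mul trmxK. Qed.

(** Moving the functional onto the noise leaves a coefficient vector that depends on [U] alone, so
    it is frozen when the noise is integrated out. *)
Lemma LS_error_functional (T d m : nat) (U : 'M[R]_(T, d)) (z : 'M[R]_(T, m))
    (f : 'cV[R]_d) a :
  \sum_k f k 0 * (gram_inv U *m U^T *m z) k a =
  \sum_i (U *m (gram_inv U *m f)) i 0 * z i a.
Proof.
have -> : \sum_k f k 0 * (gram_inv U *m U^T *m z) k a =
    (f^T *m (gram_inv U *m U^T *m z)) 0 a.
  by rewrite mxE; apply: eq_bigr => k _; rewrite [in RHS]mxE.
have -> : f^T *m (gram_inv U *m U^T *m z) = (U *m (gram_inv U *m f))^T *m z.
  by rewrite !trmx_mul gram_inv_sym !mulmxA.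
by rewrite mxE; apply: eq_bigr => i _; rewrite [_^T _ _]mxE.
Qed.

End least_squares.

(** * Tail bounds *)

Section measurable_matrix.
Context dd (S : measurableType dd) (R : realType).

Definition mx_measurable (r c : nat) (A : S -> 'M[R]_(r, c)) :=
  forall i j, measurable_fun setT (fun w => A w i j).

Lemma measurable_mulmx r c e (A : S -> 'M[R]_(r, c)) (B : S -> 'M[R]_(c, e)) :
  mx_measurable A -> mx_measurable B -> mx_measurable (fun w => A w *m B w).
Proof.
move=> mA mB i j; under eq_fun do rewrite mxE.
by apply: measurable_sum => k; apply: measurable_funM.
Qed.

Lemma measurable_trmx r c (A : S -> 'M[R]_(r, c)) :
  mx_measurable A -> mx_measurable (fun w => (A w)^T).
Proof. by move=> mA i j; under eq_fun do rewrite mxE; exact: mA. Qed.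

Lemma measurable_det n (A : S -> 'M[R]_n) :
  mx_measurable A -> measurable_fun setT (fun w => \det (A w)).
Proof.
move=> mA; rewrite /determinant; apply: measurable_sum => s.
by apply: measurable_funM => //; apply: measurable_prod => i _.
Qed.

Lemma measurable_adj n (A : S -> 'M[R]_n) :
  mx_measurable A -> mx_measurable (fun w => \adj (A w)).
Proof.
move=> mA i j; under eq_fun do rewrite mxE /cofactor.
apply: measurable_funM => //; apply: measurable_det => k l.
by under eq_fun do rewrite !mxE; exact: mA.
Qed.

Lemma measurable_gram_inv T d (U : S -> 'M[R]_(T, d)) :
  mx_measurable U -> mx_measurable (fun w => gram_inv (U w)).
Proof.
move=> mU i j; under eq_fun do rewrite mxE.
have mG : mx_measurable (fun w => (U w)^T *m U w).
  by apply: measurable_mulmx => //; exact: measurable_trmx.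
apply: measurable_funM; last exact: measurable_adj.
by apply: measurable_funV; exact: measurable_det.
Qed.

End measurable_matrix.

Section tail.
Context d (Omega : measurableType d) (R : realType) (P : probability Omega R).
Context (I : finType) (X : I -> {RV P >-> R}).
Hypothesis indepX : mutually_independent X.

Lemma measurable_fun_ge_set dd (S : measurableType dd) (f : S -> R) (t : R) :
  measurable_fun setT f -> measurable [set w | t <= f w].
Proof.
move=> mf; have := mf measurableT `[t, +oo[%classic.
rewrite setTI (_ : _ @^-1` _ = [set w | t <= f w]); first by apply.
by apply/seteqP; split => w /=; rewrite in_itv/= andbT.
Qed.

Lemma weighted_sum_sqr_measurable (K : eqType) (rs : seq K) (g : K -> seq I)
    (J : {set I}) (l : K -> Omega -> R) (b : K -> I -> Omega -> R) :
  (forall a, meas_wrt X J (l a)) -> (forall a i, meas_wrt X J (b a i)) ->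
  measurable_fun setT
    (fun w => \sum_(a <- rs) l a w * (\sum_(i <- g a) b a i w * X i w) ^+ 2).
Proof.
move=> ml mb; apply: measurable_sum => a; apply: measurable_funM.
  exact: meas_wrt_measurable (ml a).
apply: measurable_funX; apply: measurable_sum => i; apply: measurable_funM => //.
exact: meas_wrt_measurable (mb a i).
Qed.

(** Exponential Markov inequality, with the exponential parameter absorbed into the weights [l];
    negative weights yield lower tails. Each group contributes a factor at most [B]. *)
Lemma weighted_sum_sqr_tail (s : R) (K : eqType) (rs : seq K) (g : K -> seq I)
    (J : {set I}) (l : K -> Omega -> R) (b : K -> I -> Omega -> R) (B t : R) :
  0 < s -> uniq (flatten [seq g a | a <- rs]) ->
  (forall a i, a \in rs -> i \in g a -> i \notin J) ->
  (forall a i, a \in rs -> i \in g a -> has_normal_law (X i) 0 s) ->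
  (forall a, meas_wrt X J (l a)) -> (forall a i, meas_wrt X J (b a i)) ->
  (forall a w, 0 < 1 - 2 * l a w * s ^+ 2 * \sum_(i <- g a) b a i w ^+ 2) ->
  (forall a w, (Num.sqrt (1 - 2 * l a w * s ^+ 2 *
     \sum_(i <- g a) b a i w ^+ 2))^-1 <= B) ->
  (P [set w | (t <= \sum_(a <- rs) l a w *
       (\sum_(i <- g a) b a i w * X i w) ^+ 2)%R] <=
   (B ^+ size rs * expR (- t))%:E)%E.
Proof.
move=> s0 ug gJ nX ml mb D0 DB.
pose f w := \sum_(a <- rs) l a w * (\sum_(i <- g a) b a i w * X i w) ^+ 2.
have mf : measurable_fun setT f by exact: weighted_sum_sqr_measurable.
have mE : measurable [set w | t <= f w] by exact: measurable_fun_ge_set.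
rewrite -[X in (P X <= _)%E]setIT -[X in (X <= _)%E]integral_indic//.
apply: (@le_trans _ _ (\int[P]_w (expR (- t) *
    \prod_(a <- rs) expR (l a w * (\sum_(i <- g a) b a i w * X i w) ^+ 2))%:E)%E).
  have prodE w : expR (- t) * \prod_(a <- rs)
      expR (l a w * (\sum_(i <- g a) b a i w * X i w) ^+ 2) = expR (f w - t).
    by rewrite addrC expRD /f (big_morph _ (@expRD R) (@expR0 R)).
  rewrite [leRHS](_ : _ = \int[P]_w (expR (f w - t))%:E)%E; last first.
    by apply: eq_integral => w _; rewrite prodE.
  apply: ge0_le_integral => //.
  - by apply/measurable_EFinP; exact: measurable_indic.
  - apply/measurable_EFinP; apply: (measurableT_comp (@measurable_expR R)).
    exact: measurable_funB.
  - move=> w _; rewrite lee_fin indicE; case: (boolP (w \in _)) => [|_].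
      by rewrite inE /= => tf; rewrite -[leLHS]expR0 ler_expR subr_ge0.
    exact: expR_ge0.
rewrite (expect_prod_expR_sqr indepX (s := s) (J := J))//; last first.
  exact: measurable_cst.
apply: (@le_trans _ _ (\int[P]_w (B ^+ size rs * expR (- t))%:E)%E).
  apply: ge0_le_integral => //.
  - move=> w _; rewrite lee_fin; apply: mulr_ge0; first exact: expR_ge0.
    by apply: prodr_ge0 => a _; rewrite invr_ge0 sqrtr_ge0.
  - apply/measurable_EFinP; apply: measurable_funM => //.
    apply: measurable_prod => a _; apply: measurable_funV.
    apply: measurable_fun_sqrtr; apply: (@meas_wrt_measurable _ _ _ _ _ X J).
    apply: meas_wrt_gauss_factor => //; apply: meas_wrt_sum => i _.
    by apply: measurable_funX; exact: mb.
  - move=> w _; rewrite lee_fin mulrC ler_pM2r ?expR_gt0//.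
    elim: (rs) => [|a r IH]; first by rewrite big_nil expr0.
    rewrite big_cons /= [leRHS]exprS; apply: ler_pM => //.
    by apply: prodr_ge0 => a' _; rewrite invr_ge0 sqrtr_ge0.
rewrite integral_cst//.
rewrite [X in (_ * X)%E](_ : _ = 1%E); last exact: probability_setT.
by rewrite mule1.
Qed.

End tail.

Section numeric.
Context {R : realType}.

Lemma inv_sqrt_le (D : R) : 1 / 2 <= D -> (Num.sqrt D)^-1 <= 3 / 2.
Proof.
move=> D2; have D0 : 0 < D by lra.
have h : 2 / 3 <= Num.sqrt D.
  rewrite -[leLHS]ger0_norm; last lra.
  by rewrite -sqrtr_sqr ler_sqrt//; lra.
rewrite -[leRHS]invrK lef_pV2 ?posrE ?invr_gt0 ?sqrtr_gt0//; lra.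
Qed.

Lemma expR_le_inv (x : R) : x < 1 -> expR x <= (1 - x)^-1.
Proof.
move=> x1; rewrite -[leLHS]invrK -expRN lef_pV2 ?posrE ?expR_gt0 ?subr_gt0//.
exact: expR_ge1Dx.
Qed.

Lemma expRN1_le : expR (- 1 : R) <= 1 / 2.
Proof.
rewrite expRN mul1r lef_pV2 ?posrE ?expR_gt0//.
by have := expR_ge1Dx (1 : R); lra.
Qed.

End numeric.

(** * Tails for the Frobenius norm, the quadratic form of the input and the noise *)

Section tails.
Context d (Omega : measurableType d) (R : realType) (P : probability Omega R).
Context (I : finType) (X : I -> {RV P >-> R}).
Hypothesis indepX : mutually_independent X.

Lemma uniq_flatten_map (r c : nat) (iota : 'I_r -> 'I_c -> I) :
  injective (fun ij => iota ij.1 ij.2) ->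
  uniq (flatten [seq [seq iota i j | j <- enum 'I_c] | i <- enum 'I_r]).
Proof.
move=> iinj; apply: (allpairs_uniq (f := iota)); rewrite ?enum_uniq//.
by move=> [x1 x2] [y1 y2] _ _ /=; exact: (iinj (x1, x2) (y1, y2)).
Qed.

Section input.
Context (T D : nat) (iota : 'I_T -> 'I_D -> I).
Hypothesis iota_inj : injective (fun ij => iota ij.1 ij.2).
Hypothesis iota_law : forall i j, has_normal_law (X (iota i j)) 0 1.

Let U w : 'M[R]_(T, D) := \matrix_(i, j) X (iota i j) w.

Lemma frobenius_measurable : measurable [set w | 4 * (D * T)%:R <= frob2 (U w)].
Proof.
apply: measurable_fun_ge_set; apply: measurable_sum => i; apply: measurable_sum => j.
by under eq_fun do rewrite mxE; apply: measurable_funX.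
Qed.

(** Each entry is its own group with weight [1/4]: it costs [sqrt 2 <= 3/2] and gains
    [expR (-1) <= 1/2], hence [3/4] per entry. *)
Lemma frobenius_tail :
  (P [set w | (4 * (D * T)%:R <= frob2 (U w))%R] <= ((3 / 4) ^+ (D * T))%:E)%E.
Proof.
pose K := ('I_T * 'I_D)%type.
have := @weighted_sum_sqr_tail _ _ _ _ _ _ indepX 1 K (enum [set: K]%SET)
  (fun a => [:: iota a.1 a.2]) finset.set0 (fun _ _ => 1 / 4) (fun _ _ _ => 1)
  (3 / 2) (D * T)%:R.
have -> : [set w | ((D * T)%:R <= \sum_(a <- enum [set: K]%SET) 1 / 4 *
      (\sum_(i <- [:: iota a.1 a.2]) 1 * X i w) ^+ 2)%R] =
    [set w | (4 * (D * T)%:R <= frob2 (U w))%R].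
  have E w : \sum_(a <- enum [set: K]%SET) 1 / 4 *
      (\sum_(i <- [:: iota a.1 a.2]) 1 * X i w) ^+ 2 = frob2 (U w) / 4.
    rewrite big_enum/= /frob2 pair_bigA/= mulr_suml.
    apply: eq_big => [a|a _]; first by rewrite inE.
    by rewrite big_seq1 !mxE mul1r mul1r mulrC.
  by apply/seteqP; split => w /=; rewrite E; lra.
move=> h; apply: (le_trans (h _ _ _ _ _ _ _ _)) => //.
- rewrite (_ : flatten _ = [seq iota a.1 a.2 | a <- enum [set: K]%SET]).
    by rewrite map_inj_uniq ?enum_uniq.
  by elim: (enum _) => //= a s ->.
- by move=> a i _ _; rewrite inE.
- by move=> a i _; rewrite inE => /eqP ->.
- by move=> a; exact: measurable_cst.
- by move=> a i; exact: measurable_cst.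
- by move=> a w; rewrite big_seq1; lra.
- by move=> a w; apply: inv_sqrt_le; rewrite big_seq1; lra.
- rewrite lee_fin -cardE cardsT card_prod !card_ord mulnC.
  have -> : expR (- (D * T)%:R) = expR (-1 : R) ^+ (D * T).
    by rewrite -expRM_natl mulrN1.
  rewrite -exprMn.
  apply: lerXn2r; rewrite ?nnegrE ?mulr_ge0 ?expR_ge0//.
  have := @expRN1_le R; lra.
Qed.

Lemma form_lower_measurable (v : 'cV[R]_D) :
  measurable [set w | sqnorm (U w *m v) <= T%:R / 8 * sqnorm v].
Proof.
have -> : [set w | sqnorm (U w *m v) <= T%:R / 8 * sqnorm v] =
    [set w | - (T%:R / 8 * sqnorm v) <= - sqnorm (U w *m v)].
  by apply/seteqP; split => w /=; rewrite lerN2.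
apply: measurable_fun_ge_set; apply: measurable_funN; apply: measurable_sum => i.
apply: measurable_funX; under eq_fun do rewrite mxE.
apply: measurable_sum => j; apply: measurable_funM => //.
by under eq_fun do rewrite mxE; exact: measurable_funP.
Qed.

(** Each row is a group with negative weight, chosen so that its moment factor is [4^(-1/2) = 1/2].
    The threshold costs [expR (3/16) <= 16/13] per row, and [8/13 <= 5/8]. *)
Lemma form_lower_tail (v : 'cV[R]_D) : 0 < sqnorm v ->
  (P [set w | (sqnorm (U w *m v) <= T%:R / 8 * sqnorm v)%R] <= ((5 / 8) ^+ T)%:E)%E.
Proof.
move=> v0.
(* Reads [v j] off the variable index [iota i j]; injectivity leaves a single term in the sum. *)
pose coef (i : 'I_T) (k : I) : R := \sum_j (if iota i j == k then v j 0 else 0).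
have coefE i j : coef i (iota i j) = v j 0.
  rewrite /coef (bigD1 j)//= eqxx big1 ?addr0// => j' jj'.
  case: eqP => // /(@iota_inj (i, j') (i, j)) [E].
  by rewrite E eqxx in jj'.
have := @weighted_sum_sqr_tail _ _ _ _ _ _ indepX 1 _ (enum 'I_T)
  (fun i => [seq iota i j | j <- enum 'I_D]) finset.set0
  (fun _ _ => - (3 / 2) / sqnorm v) (fun i k _ => coef i k)
  (1 / 2) (- (3 / 16) * T%:R).
have -> : [set w | (- (3 / 16) * T%:R <= \sum_(i <- enum 'I_T) (- (3 / 2) / sqnorm v) *
      (\sum_(k <- [seq iota i j | j <- enum 'I_D]) coef i k * X k w) ^+ 2)%R] =
    [set w | (sqnorm (U w *m v) <= T%:R / 8 * sqnorm v)%R].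
  have E w : \sum_(i <- enum 'I_T) (- (3 / 2) / sqnorm v) *
      (\sum_(k <- [seq iota i j | j <- enum 'I_D]) coef i k * X k w) ^+ 2 =
      (- (3 / 2) / sqnorm v) * sqnorm (U w *m v).
    rewrite big_enum/= -mulr_sumr; congr (_ * _); apply: eq_bigr => i _.
    rewrite big_map big_enum/= mxE; congr (_ ^+ 2); apply: eq_bigr => j _.
    by rewrite coefE mxE mulrC.
  have key (a x y : R) : 0 < a ->
      (- (3 / 16) * y <= - (3 / 2) / a * x) = (x <= y / 8 * a).
    move=> a0; rewrite -subr_ge0 -[RHS]subr_ge0.
    rewrite (_ : _ - _ = (3 / 2) / a * (y / 8 * a - x)); last by field; rewrite gt_eqF.
    by rewrite pmulr_rge0// divr_gt0//; lra.
  by apply/seteqP; split => w /=; rewrite E key.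
have DE i : 1 - 2 * (- (3 / 2) / sqnorm v) * 1 ^+ 2 *
    \sum_(k <- [seq iota i j | j <- enum 'I_D]) coef i k ^+ 2 = 4.
  rewrite big_map big_enum/= (eq_bigr (fun j => v j 0 ^+ 2)); last first.
    by move=> j _; rewrite coefE.
  rewrite -/(sqnorm v); move: (sqnorm v) v0 => a a0.
  by field; rewrite gt_eqF.
move=> h; apply: (le_trans (h _ _ _ _ _ _ _ _)) => //.
- exact: uniq_flatten_map.
- by move=> a i _ _; rewrite inE.
- by move=> a i _ /mapP[j _ ->].
- by move=> a; exact: measurable_cst.
- by move=> a i; exact: measurable_cst.
- by move=> a w; rewrite DE.
- move=> a w; rewrite DE (_ : 4 = 2 ^+ 2 :> R); last by rewrite expr2; lra.
  by rewrite sqrtr_sqr ger0_norm// mul1r.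
- rewrite lee_fin size_enum_ord mulNr opprK.
  have -> : expR (3 / 16 * T%:R) = expR (3 / 16 : R) ^+ T.
    by rewrite -expRM_natl mulrC.
  rewrite -exprMn.
  apply: lerXn2r; rewrite ?nnegrE ?mulr_ge0 ?expR_ge0//.
  have : expR (3 / 16 : R) <= (1 - 3 / 16)^-1 by apply: expR_le_inv; lra.
  have -> : (1 - 3 / 16 : R)^-1 = 16 / 13 by field.
  lra.
Qed.

End input.

(** Each output is a group. Since [v] has squared norm at most [V], the weight [(4 sigma^2 V)^-1]
    keeps the Gaussian factor at least [1/2], so each output costs at most [3/2]. *)
Lemma noise_tail (T m : nat) (kap : 'I_T -> 'I_m -> I) (J : {set I}) (sigma V t : R)
    (v : 'I_T -> Omega -> R) :
  injective (fun ij => kap ij.1 ij.2) -> (forall i a, kap i a \notin J) ->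
  (forall i a, has_normal_law (X (kap i a)) 0 sigma) -> 0 < sigma -> 0 < V ->
  (forall i, meas_wrt X J (v i)) -> (forall w, \sum_i v i w ^+ 2 <= V) ->
  let S := [set w | t <= (4 * sigma ^+ 2 * V)^-1 *
    \sum_a (\sum_i v i w * X (kap i a) w) ^+ 2] in
  measurable S /\ (P S <= ((3 / 2) ^+ m * expR (- t))%:E)%E.
Proof.
move=> kinj kJ klaw s0 V0 mv vV S.
pose b (a : 'I_m) (k : I) (w : Omega) : R :=
  \sum_i (if kap i a == k then v i w else 0).
have bE a i w : b a (kap i a) w = v i w.
  rewrite /b (bigD1 i)//= eqxx big1 ?addr0// => i' ii'.
  case: eqP => // /(kinj (i', a) (i, a)) [E].
  by rewrite E eqxx in ii'.
have mb a k : meas_wrt X J (b a k).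
  apply: meas_wrt_sum => i _; case: eqP => // _; exact: measurable_cst.
pose l : R := (4 * sigma ^+ 2 * V)^-1.
have kinj' : injective (fun ij => kap ij.2 ij.1).
  by move=> [a i] [a' i'] /= /(kinj (i, a) (i', a')) [-> ->].
have ml (a : 'I_m) : meas_wrt X J (fun=> l) by exact: measurable_cst.
have SE : S = [set w | t <= \sum_(a <- enum 'I_m) l *
      (\sum_(k <- [seq kap i a | i <- enum 'I_T]) b a k w * X k w) ^+ 2].
  have E w : \sum_(a <- enum 'I_m) l *
      (\sum_(k <- [seq kap i a | i <- enum 'I_T]) b a k w * X k w) ^+ 2 =
      l * \sum_a (\sum_i v i w * X (kap i a) w) ^+ 2.
    rewrite big_enum/= mulr_sumr; apply: eq_bigr => a _.
    rewrite big_map big_enum/=; congr (_ * _ ^+ 2); apply: eq_bigr => i _.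
    by rewrite bE.
  by apply/seteqP; split => w; rewrite /S /= E.
have DE a w : 1 / 2 <= 1 - 2 * l * sigma ^+ 2 *
    \sum_(k <- [seq kap i a | i <- enum 'I_T]) b a k w ^+ 2.
  rewrite big_map big_enum/= (eq_bigr (fun i => v i w ^+ 2)); last first.
    by move=> i _; rewrite bE.
  have -> : 2 * l * sigma ^+ 2 * \sum_i v i w ^+ 2 = (\sum_i v i w ^+ 2) / V / 2.
    rewrite /l; move: (\sum_i _) => x; field; by rewrite !gt_eqF.
  have : (\sum_i v i w ^+ 2) / V <= 1 by rewrite ler_pdivrMr// mul1r.
  by lra.
rewrite SE; split.
  apply: measurable_fun_ge_set.
  exact: (weighted_sum_sqr_measurable _ _ ml mb).
have := @weighted_sum_sqr_tail _ _ _ _ _ _ indepX sigma _ (enum 'I_m)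
  (fun a => [seq kap i a | i <- enum 'I_T]) J (fun _ _ => l) b (3 / 2) t.
rewrite size_enum_ord; apply => //.
- exact: (@uniq_flatten_map _ _ (fun a i => kap i a)).
- by move=> a k _ /mapP[i _ ->].
- by move=> a k _ /mapP[i _ ->].
- by move=> a w; have := DE a w; lra.
- by move=> a w; exact: inv_sqrt_le.
Qed.

End tails.

(** * Fourier functionals and the final estimate *)

Lemma union_bound d (Omega : measurableType d) (R : realType)
    (P : probability Omega R) (K : eqType) (s : seq K) (A : K -> set Omega) (c : R) :
  (forall k, measurable (A k)) -> (forall k, (P (A k) <= c%:E)%E) ->
  measurable [set w | exists2 k, k \in s & A k w] /\
  (P [set w | exists2 k, k \in s & A k w] <= ((size s)%:R * c)%:E)%E.
Proof.
move=> mA PA; elim: s => [|k s [mS PS]].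
  have -> : [set w | exists2 k, k \in [::] & A k w] = set0.
    by apply/seteqP; split => // w [].
  by rewrite measure0 mul0r.
have -> : [set w | exists2 k', k' \in k :: s & A k' w] =
    A k `|` [set w | exists2 k, k \in s & A k w].
  apply/seteqP; split => w /=.
    by move=> [k']; rewrite in_cons => /orP[/eqP-> ?|? ?]; [left|right; exists k'].
  by move=> [Ak|[k' k's Ak']]; [exists k; rewrite ?mem_head|
    exists k' => //; rewrite in_cons k's orbT].
split; first exact: measurableU.
apply: le_trans (measureU2 _ (mA k) mS) _.
by rewrite /= -nat1r mulrDl mul1r EFinD; exact: leeD.
Qed.

Section fourier_vector.
Context {R : realType}.

Definition trig (e : bool) : R -> R := if e then cos else sin.

Lemma trig_sqr_le1 e x : trig e x ^+ 2 <= 1.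
Proof.
by case: e => /=; [rewrite cos2sin2|rewrite sin2cos2]; rewrite gerBl sqr_ge0.
Qed.

Lemma block_index_subproof (N p : nat) (l : 'I_N) (b : 'I_p) : (l * p + b < N * p)%N.
Proof.
have := ltn_ord b; have := ltn_ord l => lN bp.
by apply: (@leq_trans (l * p + p)); rewrite ?ltn_add2l// -mulSnr leq_mul2r lN orbT.
Qed.

Definition block_index (N p : nat) (l : 'I_N) (b : 'I_p) : 'I_(N * p) :=
  Ordinal (block_index_subproof l b).

Lemma block_index_inj N p (b : 'I_p) : injective (fun l : 'I_N => block_index l b).
Proof.
move=> l l' [/eqP]; rewrite eqn_add2r eqn_mul2r => /orP[/eqP p0|/eqP]; last exact: val_inj.
by have := ltn_ord b; rewrite {2}p0.
Qed.

Definition fourier_vec (N p : nat) (e : bool) (j : nat) (b : 'I_p) : 'cV[R]_(N * p) :=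
  \sum_(l < N) trig e (freq N j * l%:R) *: delta_mx (block_index l b) 0.

Lemma fourier_vec_dot N p e j (b : 'I_p) (g : 'I_(N * p) -> R) :
  \sum_k fourier_vec N e j b k 0 * g k =
  \sum_(l < N) trig e (freq N j * l%:R) * g (block_index l b).
Proof.
under eq_bigr do rewrite summxE mulr_suml.
rewrite exchange_big/=; apply: eq_bigr => l _.
rewrite (bigD1 (block_index l b))//= big1 ?addr0 => [|k kl].
  by rewrite !mxE !eqxx mulr1.
by rewrite !mxE (negbTE kl) mulr0 mul0r.
Qed.

Lemma sqnorm_fourier_vec N p e j (b : 'I_p) :
  sqnorm (fourier_vec N e j b) <= N%:R.
Proof.
rewrite /sqnorm; under eq_bigr do rewrite expr2.
rewrite fourier_vec_dot -[leRHS]mul1r -[N in leRHS]card_ord mulr_natr -sumr_const.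
apply: ler_sum => l _.
have -> : fourier_vec N e j b (block_index l b) 0 = trig e (freq N j * l%:R).
  rewrite summxE (bigD1 l)//= big1 ?addr0 => [|l' ll'].
    by rewrite !mxE !eqxx mulr1.
  rewrite !mxE; case: eqP => [/(@block_index_inj N p b) E|]; last by rewrite mulr0.
  by rewrite E eqxx in ll'.
by rewrite -expr2 trig_sqr_le1.
Qed.

Lemma mxnat_block N p m (h : 'M[R]_(N * p, m)) (l : 'I_N) (b : 'I_p) (a : 'I_m) :
  mxnat h (l * p + b) a = h (block_index l b) a.
Proof.
rewrite /mxnat (insubT (fun i => i < N * p)%N (block_index_subproof l b)).
by rewrite (insubT (fun i => i < m)%N (ltn_ord a)); congr (h _ _); apply: val_inj.
Qed.

(** The squared Frobenius norm of the symbol at one frequency collects a cosine and a sine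
    functional for each of the [p] rows, whence [2 p S]. *)
Lemma specnorm_hankel_le (n p m : nat) (g : 'M[R]_((2 * n - 1) * p, m)) (M S : R) :
  (0 < p)%N -> (0 < m)%N -> 0 <= M -> 2 * p%:R * S <= M ^+ 2 ->
  (forall e (j : 'I_(2 * n - 1)) (b : 'I_p),
    \sum_(a < m) (\sum_k fourier_vec (2 * n - 1) e j b k 0 * g k a) ^+ 2 <= S) ->
  specnorm (hankel g) <= M.
Proof.
move=> p0 m0 M0 SM gS; apply: specnorm_le => //; apply: hankel_mulmx_bound => // j.
rewrite exchange_big/=; apply: (@le_trans _ _ (\sum_(b < p) (S + S))); last first.
  by rewrite sumr_const card_ord -mulr_natr; move: SM; lra.
apply: ler_sum => b _; rewrite big_split/=; apply: lerD.
- apply: le_trans (gS true j b); apply: ler_sum => a _; rewrite fourier_vec_dot.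
  rewrite le_eqVlt; apply/orP; left; apply/eqP; congr (_ ^+ 2).
  by apply: eq_bigr => l _; rewrite mxnat_block mulrC.
- apply: le_trans (gS false j b); apply: ler_sum => a _; rewrite fourier_vec_dot.
  rewrite le_eqVlt; apply/orP; left; apply/eqP; congr (_ ^+ 2).
  by apply: eq_bigr => l _; rewrite mxnat_block mulrC.
Qed.

End fourier_vector.

(** * Numerical constants *)

Section constants.
Context {R : realType}.

Lemma ln2_ge_half : 1 / 2 <= ln (2 : R).
Proof.
rewrite -[leLHS]expRK ler_ln ?posrE ?expR_gt0//.
apply: (@le_trans _ _ (1 - 1 / 2)^-1); first by apply: expR_le_inv; lra.
by rewrite (_ : 1 - 1 / 2 = 2^-1 :> R) ?invrK//; lra.
Qed.

Lemma three_halves_expRN1_le1 : 3 / 2 * expR (- 1 : R) <= 1.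
Proof. by have := @expRN1_le R; lra. Qed.

Lemma pow_half_le_inv (q : nat) : (0 < q)%N -> (1 / 2 : R) ^+ q <= q%:R^-1.
Proof.
move=> q0; rewrite mul1r exprVn lef_pV2 ?posrE ?exprn_gt0 ?ltr0n//.
by rewrite -natrX ler_nat ltnW// ltn_expl.
Qed.

(** [(3/4)^3 <= 1/2] and [D T >= 3 q], so the left side is at most [2^-q]. *)
Lemma frobenius_failure_le (q D T : nat) : (0 < q)%N -> (q <= D)%N -> (3 <= T)%N ->
  (3 / 4 : R) ^+ (D * T) <= q%:R^-1.
Proof.
move=> q0 qD T3; apply: le_trans (pow_half_le_inv q0).
apply: (@le_trans _ _ ((3 / 4) ^+ (3 * q))).
  by apply: ler_wiXn2l; [lra|lra|rewrite mulnC leq_mul].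
by rewrite exprM; apply: lerXn2r; rewrite ?nnegrE ?exprn_ge0 ?divr_ge0//;
  rewrite !exprS expr0; lra.
Qed.

(** The count is [2^(36 D) <= 2^(72 q)], while [(5/8)^3 <= 1/4] and [T >= 3 * 37 q] give a tail of
    [2^(-74 q)]. *)
Lemma lattice_failure_le (q D T : nat) : (0 < q)%N -> (D <= 2 * q)%N ->
  (111 * q <= T)%N ->
  (2 : R) ^+ (34 * D) * 4 ^+ D * (5 / 8) ^+ T <= q%:R^-1.
Proof.
move=> q0 Dq qT; apply: le_trans (pow_half_le_inv q0).
have -> : (2 : R) ^+ (34 * D) * 4 ^+ D = 2 ^+ (36 * D).
  rewrite (_ : 4 = 2 ^+ 2 :> R); last by rewrite expr2; lra.
  by rewrite -exprM -exprD -mulnDl.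
have h1 : (2 : R) ^+ (36 * D) <= 2 ^+ (72 * q).
  by rewrite ler_weXn2l ?ler1n//; lia.
have h2 : (5 / 8 : R) ^+ T <= (1 / 2) ^+ (74 * q).
  apply: (@le_trans _ _ ((5 / 8) ^+ (3 * (37 * q)))).
    by apply: ler_wiXn2l; [lra|lra|lia].
  rewrite (_ : 74 * q = 2 * (37 * q))%N; last lia.
  rewrite !exprM.
  do 2 (apply: lerXn2r; rewrite ?nnegrE ?exprn_ge0 ?divr_ge0//).
  by rewrite !exprS expr0; lra.
apply: (@le_trans _ _ (2 ^+ (72 * q) * (1 / 2) ^+ (74 * q))).
  by apply: ler_pM => //; rewrite exprn_ge0 ?divr_ge0.
rewrite (_ : 74 * q = 72 * q + 2 * q)%N; last lia.
rewrite exprD mulrA -exprMn (_ : 2 * (1 / 2) = 1 :> R); last lra.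
by rewrite expr1n [leLHS]mul1r; apply: ler_wiXn2l; [lra|lra|lia].
Qed.

(** [L >= 1/2] and [m >= 1] give [m + 3 L <= 10 m L^2]; with [N <= 2 n] the numerical factor is
    [128 * 2 * 10 = 2560 <= 51^2]. *)
Lemma hankel_bound_constants (N n p m : nat) (sigma T L : R) :
  0 < T -> N%:R <= 2 * n%:R :> R -> 1 / 2 <= L -> 1 <= m%:R :> R ->
  2 * p%:R * (4 * sigma ^+ 2 * (N%:R / (T / 16)) * (m%:R + 3 * L)) <=
  51 ^+ 2 * sigma ^+ 2 * ((m * n * p)%:R / T) * L ^+ 2.
Proof.
move=> T0 Nn L2 m1; rewrite !natrM -subr_ge0.
have -> : 51 ^+ 2 * sigma ^+ 2 * (m%:R * n%:R * p%:R / T) * L ^+ 2 -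
    2 * p%:R * (4 * sigma ^+ 2 * (N%:R / (T / 16)) * (m%:R + 3 * L)) =
    (sigma ^+ 2 * p%:R / T) *
    (2601 * n%:R * (m%:R * L ^+ 2) - 128 * N%:R * (m%:R + 3 * L)).
  by field; rewrite gt_eqF.
apply: mulr_ge0; first by rewrite divr_ge0 ?(ltW T0)// mulr_ge0// sqr_ge0.
have h : m%:R + 3 * L <= 10 * (m%:R * L ^+ 2).
  move: (m%:R : R) m1 => x x1.
  have h1 : 0 <= x * (L ^+ 2 - 1 / 4) by apply: mulr_ge0; nra.
  have h2 : 0 <= (x - 1) * L by apply: mulr_ge0; lra.
  have h3 : 0 <= x * (L * (L - 1 / 2)) by apply: mulr_ge0; nra.
  by nra.
have y0 : 0 <= m%:R + 3 * L by lra.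
have n0 : 0 <= n%:R :> R by [].
move: (m%:R * L ^+ 2) (m%:R + 3 * L) h y0 => a b h y0.
have h1 : N%:R * b <= 2 * n%:R * b by rewrite ler_wpM2r.
have h2 : n%:R * b <= n%:R * (10 * a) by rewrite ler_wpM2l.
have h3 : 0 <= n%:R * a by apply: mulr_ge0 => //; lra.
by nra.
Qed.

End constants.

Theorem theorem3 (R : realType) :
  exists C1 C2 C3 c : R, 0 < C1 /\ 0 < C2 /\ 0 < C3 /\ 0 < c /\
  forall (n p m T : nat) (sigma_z : R)
    (d : measure_display) (Omega : measurableType d) (P : probability Omega R)
    (U : 'I_T -> 'I_((2 * n - 1) * p) -> {RV P >-> R})
    (z : 'I_T -> 'I_m -> {RV P >-> R})
    (h : 'M[R]_((2 * n - 1) * p, m)),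
    (0 < n)%N -> (0 < p)%N -> (0 < m)%N -> (1 < n * p)%N ->
    0 < sigma_z ->
    C1 * (m * n * p)%:R <= T%:R ->
    mutually_independent
      (fun k : ('I_T * 'I_((2 * n - 1) * p) + 'I_T * 'I_m)%type =>
         match k with inl ij => U ij.1 ij.2 | inr ij => z ij.1 ij.2 end) ->
    (forall i j, has_normal_law (U i j) 0 1) ->
    (forall i j, has_normal_law (z i j) 0 sigma_z) ->
    exists E : set Omega, measurable E /\
      ((1 - C3 * powR (n * p)%:R (- c))%:E <= P E)%E /\
      forall w, E w ->
        forall hhat : 'M[R]_((2 * n - 1) * p, m),
          is_LS_solution (rmx U w) (rmx U w *m h + rmx z w) hhat ->
          specnorm (hankel (hhat - h))
            <= C2 * sigma_z * Num.sqrt ((m * n * p)%:R / T%:R) * ln ((n * p)%:R).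
Proof.
(* [111] pays for the union bound over lattice points and [51] comes from [hankel_bound_constants].
   The failure probability is at most [(1 + 1 + 2) / (n p)], for the Frobenius norm, the lattice
   points and the noise. *)
exists 111, 51, 4, 1; do 4 (split; first by []).
move=> n p m T sigma d Omega P U z h n0 p0 m0 np1 s0 TC indep lawU lawz.
set N := (2 * n - 1)%N in U h indep lawU *; set D := (N * p)%N in U h indep lawU *.
set X := (fun k => _) in indep.
pose q := (n * p)%N; pose L : R := ln q%:R.
have T111 : (111 * (m * n * p) <= T)%N by rewrite -(ler_nat R) natrM.
have qT : (111 * q <= T)%N.
  apply: leq_trans T111; rewrite leq_mul2l/= /q -mulnA leq_pmull//.
have q2 : (1 < q)%N by [].
have T0 : (0 < T)%N by apply: leq_trans qT; rewrite muln_gt0 (ltnW q2).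
have N0 : (0 < N)%N by rewrite /N; lia.
have D0 : (0 < D)%N by rewrite muln_gt0 N0.
have qD : (q <= D)%N by rewrite leq_mul2r; apply/orP; right; rewrite /N; lia.
have Dq : (D <= 2 * q)%N by rewrite mulnA leq_mul2r; apply/orP; right; rewrite /N; lia.
have D4 : (2 * N * p <= 4 * q)%N.
  by rewrite -mulnA (_ : 4 * q = 2 * (2 * q))%N ?leq_mul2l// mulnA.
have L_half : 1 / 2 <= L.
  by apply: le_trans ln2_ge_half _; rewrite ler_ln ?posrE ?ltr0n ?ler_nat// ltnW.
have T0R : 0 < T%:R :> R by rewrite ltr0n.
have N0R : 0 < N%:R :> R by rewrite ltr0n.
pose V : R := N%:R / (T%:R / 16).
have V0 : 0 < V by rewrite !divr_gt0.
pose iota (i : 'I_T) (j : 'I_D) : 'I_T * 'I_D + 'I_T * 'I_m := inl (i, j).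
pose kap (i : 'I_T) (a : 'I_m) : 'I_T * 'I_D + 'I_T * 'I_m := inr (i, a).
have iota_inj : injective (fun ij => iota ij.1 ij.2).
  by move=> [i j] [i' j'] /= [-> ->].
have kap_inj : injective (fun ij => kap ij.1 ij.2).
  by move=> [i j] [i' j'] /= [-> ->].
(* The input variables: being measurable with respect to [J] means being a function of [U], as the
   noise coefficients are. *)
pose J := finset (fun k : 'I_T * 'I_D + 'I_T * 'I_m => if k is inl _ then true else false).
have UE w : \matrix_(i, j) X (iota i j) w = rmx U w by [].
pose x (k : bool * 'I_N * 'I_p) w : 'cV[R]_T :=
  rmx U w *m (gram_inv (rmx U w) *m fourier_vec N k.1.1 k.1.2 k.2).
(* The truncation makes the norm bound hold at every point, as the exponential moment
   requires; it is inactive on the final event. *)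
pose v k i w : R := if sqnorm (x k w) <= V then x k w i 0 else 0.
have mU : @mx_measurable _ (sub_space X J) R T D (rmx U).
  move=> i j; under eq_fun do rewrite mxE.
  by apply: (@meas_wrt_RV _ _ _ _ _ X J (iota i j)); rewrite inE.
have mx k : @mx_measurable _ (sub_space X J) R T 1 (x k).
  apply: measurable_mulmx => //; apply: measurable_mulmx.
    exact: measurable_gram_inv.
  by move=> i j; exact: measurable_cst.
have mv k i : meas_wrt X J (v k i).
  apply: measurable_fun_ifT => //; last exact: mx.
  apply: measurable_fun_ler => //.
  by apply: measurable_sum => i'; apply: measurable_funX; exact: mx.
have vV k w : \sum_i v k i w ^+ 2 <= V.
  rewrite /v; case: (boolP (sqnorm (x k w) <= V)) => // _.
  by rewrite big1 ?ltW// => i _; rewrite expr0n.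
(* The term [m] pays for [(3/2)^m], and [3 L] leaves [q^-3]; the union over at most [4 q] vectors
   then costs [4 / q^2 <= 2 / q], as [q >= 2]. *)
pose t : R := m%:R + 3 * L.
pose E1 := [set w | 4 * (D * T)%:R <= frob2 (rmx U w)].
(* At the zero vector the event would be everything; it is replaced by the empty set, since the
   lower bound is trivial there. *)
pose E2 (k : {ffun 'I_D -> bool * 'I_(34 * D).+1}) : set Omega :=
  if 0 < sqnorm (lattice_vec k : 'cV[R]_D) then
    [set w | sqnorm (rmx U w *m lattice_vec k) <= T%:R / 8 * sqnorm (lattice_vec k)]
  else set0.
pose E3 k := [set w | t <= (4 * sigma ^+ 2 * V)^-1 *
    \sum_a (\sum_i v k i w * X (kap i a) w) ^+ 2].
have mE1 : measurable E1 by exact: (frobenius_measurable X iota).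
have PE1 : (P E1 <= (q%:R^-1)%:E)%E.
  apply: (le_trans (frobenius_tail indep iota_inj lawU)).
  by rewrite lee_fin; apply: frobenius_failure_le => //; lia.
have mE2 k : measurable (E2 k).
  by rewrite /E2; case: ifP => // _; exact: (form_lower_measurable X iota).
have PE2 k : (P (E2 k) <= ((5 / 8) ^+ T)%:E)%E.
  rewrite /E2; case: ifPn => [k0|_]; first exact: (form_lower_tail indep iota_inj lawU).
  by rewrite measure0 lee_fin exprn_ge0 ?divr_ge0.
have E3P k : measurable (E3 k) /\ (P (E3 k) <= ((3 / 2) ^+ m * expR (- t))%:E)%E.
  by apply: (noise_tail indep (J := J)) => // i a; rewrite inE.
have [mB2 PB2] := union_bound (enum (lattice_ball D (34 * D))) mE2 PE2.
have [mB3 PB3] := union_bound (enum [set: bool * 'I_N * 'I_p]%SET)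
  (fun k => (E3P k).1) (fun k => (E3P k).2).
set B2 := [set w | _] in mB2 PB2; set B3 := [set w | _] in mB3 PB3.
exists (~` (E1 `|` (B2 `|` B3))); split.
  by apply: measurableC; apply: measurableU => //; exact: measurableU.
split.
  rewrite probability_setC; last by apply: measurableU => //; exact: measurableU.
  have PB : (P (E1 `|` (B2 `|` B3)) <= (4 * q%:R^-1)%:E)%E.
    apply: (le_trans (measureU2 _ mE1 (measurableU _ _ mB2 mB3))).
    rewrite (_ : 4 * q%:R^-1 = q%:R^-1 + (q%:R^-1 + 2 * q%:R^-1)); last by ring.
    rewrite !EFinD; apply: leeD => //; apply: (le_trans (measureU2 _ mB2 mB3)).
    apply: leeD.
      apply: (le_trans PB2); rewrite lee_fin -cardE.
      apply: le_trans (lattice_failure_le (ltnW q2) Dq qT).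
      by rewrite ler_pM2r ?exprn_gt0 ?divr_gt0//; exact: card_lattice_ball.
    apply: (le_trans PB3); rewrite lee_fin -cardE cardsT !card_prod !card_ord card_bool.
    have q0R : 0 < q%:R :> R by rewrite ltr0n ltnW.
    have et : expR (- t) = expR (- 1) ^+ m * q%:R^-1 ^+ 3.
      rewrite /t opprD expRD -expRM_natl mulrN1; congr (_ * _).
      by rewrite -mulrN expRM_natl expRN lnK ?posrE.
    have em : (3 / 2) ^+ m * expR (- t) <= q%:R^-1 ^+ 3.
      rewrite et mulrA -exprMn ler_piMl ?exprn_ge0 ?invr_ge0//.
      apply: exprn_ile1; first by rewrite mulr_ge0 ?expR_ge0 ?divr_ge0.
      exact: three_halves_expRN1_le1.
    apply: (@le_trans _ _ ((4 * q%:R) * q%:R^-1 ^+ 3)).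
      apply: ler_pM => //.
      by rewrite -natrM ler_nat.
    rewrite (_ : 4 * q%:R * q%:R^-1 ^+ 3 = 2 * q%:R^-1 * (2 / q%:R)); last first.
      by field; rewrite gt_eqF.
    rewrite ler_piMr ?mulr_ge0 ?invr_ge0//.
    by rewrite ler_pdivrMr// mul1r ler_nat.
  rewrite EFinB; apply: leeB => //.
  by rewrite powRN powRr1.
move=> w Ew hh LS.
have [nE1 nB2 nB3] : [/\ ~ E1 w, ~ B2 w & ~ B3 w].
  by split => ?; apply: Ew; [left|right; left|right; right].
have low y : T%:R / 16 * sqnorm y <= sqnorm (rmx U w *m y).
  apply: gram_lower_bound => //.
    move=> k kB; have [k0|k0] := ltP 0 (sqnorm (lattice_vec k : 'cV[R]_D)).
      rewrite leNgt; apply/negP => /ltW lt; apply: nB2; exists k; rewrite ?mem_enum//.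
      by rewrite /E2 k0.
    have -> : sqnorm (lattice_vec k : 'cV[R]_D) = 0.
      by apply/eqP; rewrite eq_le k0 sqnorm_ge0.
    by rewrite mulr0 sqnorm_ge0.
  rewrite exchange_big/= leNgt; apply/negP => /ltW lt; exact: nE1.
have c0 : 0 < T%:R / 16 :> R by rewrite divr_gt0.
have dE := LS_solutionE c0 low LS.
have xV k : sqnorm (x k w) <= V.
  apply: (le_trans (sqnorm_gram_inv_le c0 low _)).
  by rewrite ler_pM2r ?invr_gt0//; exact: sqnorm_fourier_vec.
apply: (@specnorm_hankel_le R n p m _ _ (4 * sigma ^+ 2 * V * t)) => //.
- by rewrite !mulr_ge0 ?sqrtr_ge0 ?(ltW s0)//; move: L_half; rewrite /L /q; lra.
- have mnpT : 0 <= (m * n * p)%:R / T%:R :> R by rewrite divr_ge0.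
  rewrite !exprMn sqr_sqrtr// -/q -/L /V /t.
  apply: hankel_bound_constants => //; last by rewrite ler1n.
  by rewrite -natrM ler_nat leq_subr.
- move=> e j b.
  have : ~ E3 (e, j, b) w.
    by move=> E3w; apply: nB3; exists (e, j, b) => //; rewrite mem_enum inE.
  rewrite /E3 /= => /negP; rewrite -ltNge => /ltW.
  have s4 : 0 < 4 * sigma ^+ 2 * V.
    by apply: mulr_gt0 => //; apply: mulr_gt0 => //; exact: exprn_gt0.
  rewrite mulrC ler_pdivrMr// mulrC; apply: le_trans.
  apply: ler_sum => a _; rewrite dE (LS_error_functional (rmx U w)).
  rewrite le_eqVlt; apply/orP; left; apply/eqP; congr (_ ^+ 2).
  by apply: eq_bigr => i _; rewrite /v xV [rmx z w i a]mxE.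
Qed.
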